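(* Let $p$ be a prime, let $H$ be a finite group, and let $V$ be a simple $\mathbb{Z}_pH$-module. Let $F$ be the free group on $\{x_1,\ldots,x_e\}$ with an epimorphism $\psi\colon F\to H$. Let $\gamma_1,\ldots,\gamma_d\in Z^2(H,V)$ be such that their images in $H^2(H,V)$ form a $\mathbb{Z}_p$-basis. For each $i$, let $E_i=E_{\gamma_i}$ with projection $\varepsilon_i\colon E_i\to H$, and let $\varrho_i\colon F\to E_i$ be the homomorphism defined by $\varrho_i(x_k)=(\psi(x_k),1)\in E_i$ for all $k$, so that $\varepsilon_i(\varrho_i(x_k))=\psi(x_k)$. Define \[\rho=\Psi_{V,e}\times\varrho_1\times\cdots\times\varrho_d\colon F\to (H\ltimes V^r)^e\times E_1\times\cdots\times E_d,\] with $r$ and $\Psi_{V,e}$ as in the context. Then $\ker\rho=\ker(\eta\circ\Psi_p)$ and $\rho(F)\cong\hat H_{V,e}$.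
   Context: Modules are finite-dimensional right modules. A $\mathbb{Z}_pH$-module is $V$-homogeneous if it is a direct sum of finitely many (possibly zero) copies of $V$. For a $\mathbb{Z}_pH$-module $A$, $V(A)$ denotes the smallest submodule of $A$ such that $A/V(A)$ is $V$-homogeneous. Covers: let $M=\ker\psi$ and $M_p=[M,M]M^{[p]}$, where $M^{[p]}$ is the subgroup generated by all $p$-th powers of elements of $M$. Then $M/M_p$ is a $\mathbb{Z}_pH$-module, $g\in H$ acting by conjugation by any $\psi$-preimage. Put $\hat H_{p,e}=F/M_p$ and $\hat H_{V,e}=\hat H_{p,e}/V(M/M_p)$. Let $\eta\colon\hat H_{p,e}\to\hat H_{V,e}$ be the natural projection. Let $R_{H,p}=\mathbb{Z}_pH$ be the regular right module and let $\Psi_p=\mu_1\times\cdots\times\mu_e\colon F\to(H\ltimes R_{H,p})^e$, where $\mu_j(x_k)=(\psi(x_k),0)$ for $k\neq j$ and $\mu_j(x_j)=(\psi(x_j),1)$, with $1$ the identity of $\mathbb{Z}_pH$; here semidirect products have multiplication $(a,u)(b,v)=(ab,u^b+v)$. One has $\ker\Psi_p=M_p$, and $\hat H_{p,e}$ and $M/M_p$ are identified with $\Psi_p(F)$ and $\Psi_p(M)$; so $\eta\circ\Psi_p\colon F\to\hat H_{V,e}$ is, under this identification, the natural projection of $F$. The map $\Psi_{V,e}$: let $r$ be the dimension of an absolutely simple constituent of $V$ after extending scalars to an algebraic closure (or finite splitting field) of $\mathbb{Z}_p$. Then $V^r\cong R_{H,p}/V(R_{H,p})$ is a cyclic $\mathbb{Z}_pH$-module;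 let $z\in V^r$ be a cyclic generator. For $j\in\{1,\ldots,e\}$ let $\psi_j'\colon F\to H\ltimes V^r$ be the homomorphism with $\psi_j'(x_j)=(\psi(x_j),z)$ and $\psi_j'(x_k)=(\psi(x_k),0)$ for $k\neq j$. Then $\Psi_{V,e}=\psi_1'\times\cdots\times\psi_e'\colon F\to(H\ltimes V^r)^e$. For $\gamma\in Z^2(H,V)$ (with $V$ written multiplicatively), $E_\gamma$ is the group with underlying set $H\times V$ and multiplication $(g,v)\cdot(h,w)=(gh,\,v^hw\gamma(g,h))$, with natural epimorphism $E_\gamma\to H$, $(h,v)\mapsto h$. *)

(* Defs.v *)
From HB Require Import structures.
From mathcomp Require Import all_boot all_order all_algebra all_fingroup.
From mathcomp Require Import mxrepresentation.
From mathcomp Require Import boolp.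

Set Implicit Arguments.
Unset Strict Implicit.
Unset Printing Implicit Defensive.

Import GroupScope GRing.Theory.

(* The free group on x_0, ..., x_{e-1}: reduced words in the letters (k, b),  *)
(* where (k, false) stands for x_k and (k, true) for x_k^-1.                  *)

Section FreeGroup.
Variable e : nat.

Definition letter : Type := 'I_e * bool.

Definition inv_letter (a : letter) : letter := (a.1, ~~ a.2).

Fixpoint reduced (s : seq letter) : bool :=
  if s is a :: s' then
    (if s' is b :: _ then a != inv_letter b else true) && reduced s'
  else true.

Definition push (a : letter) (s : seq letter) : seq letter :=
  if s is b :: s' then if a == inv_letter b then s' else a :: s else [:: a].

Lemma inv_letterK : involutive inv_letter.
Proof. by case=> k b; rewrite /inv_letter /= negbK. Qed.

Lemma inv_letter_neq a : (a == inv_letter a) = false.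
Proof. by case: a => k b; rewrite /inv_letter xpair_eqE /=; case: b; rewrite andbF. Qed.

Lemma push_reduced a s : reduced s -> reduced (push a s).
Proof.
case: s => [|b s] //= /andP[bs rs]; case: (eqVneq a (inv_letter b)) => //= nab.
by rewrite nab bs rs.
Qed.

Lemma pushK a s : reduced s -> push (inv_letter a) (push a s) = s.
Proof.
case: s => [|b s] /=; first by rewrite eqxx.
move=> /andP[bs rs]; case: (eqVneq a (inv_letter b)) => [->|nab] /=.
  rewrite inv_letterK; case: s bs rs => [|c s] //= bc _.
  by rewrite (negPf bc).
by rewrite eqxx.
Qed.

Lemma foldr_push_reduced u s : reduced s -> reduced (foldr push s u).
Proof. by move=> rs; elim: u => //= a u; apply: push_reduced. Qed.

Lemma foldr_push_push a s t :
  reduced s -> foldr push s (push a t) = push a (foldr push s t).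
Proof.
move=> rs; case: t => [|b t] //=; case: (eqVneq a (inv_letter b)) => [->|//].
by rewrite pushK // foldr_push_reduced.
Qed.

Lemma foldr_push_foldr s t u :
  reduced s -> foldr push s (foldr push t u) = foldr push (foldr push s t) u.
Proof. by move=> rs; elim: u => //= a u IH; rewrite foldr_push_push // IH. Qed.

Lemma foldr_push_nil s : reduced s -> foldr push [::] s = s.
Proof.
elim: s => //= a s IH /andP[as_ rs]; rewrite IH //.
by case: s as_ {IH rs} => [|b s] //= /negPf->.
Qed.

Record free_group : Type :=
  FreeWord { word : seq letter; _ : reduced word }.

HB.instance Definition _ := [isSub for word].
HB.instance Definition _ := [Choice of free_group by <:].

Implicit Types u v w : free_group.

Lemma word_reduced w : reduced (word w). Proof. exact: valP w. Qed.

Definition fg_one : free_group := @FreeWord [::] isT.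

Definition fg_mul u v : free_group :=
  FreeWord (foldr_push_reduced (word u) (word_reduced v)).

Definition fg_inv u : free_group :=
  FreeWord (foldr_push_reduced (map inv_letter (rev (word u))) (word_reduced fg_one)).

Lemma fg_mulA : associative fg_mul.
Proof.
by move=> u v w; apply: val_inj; rewrite /= foldr_push_foldr // word_reduced.
Qed.

Lemma fg_mul1 : left_id fg_one fg_mul.
Proof. by move=> u; apply: val_inj. Qed.

Lemma fg_mulr1 : right_id fg_one fg_mul.
Proof. by move=> u; apply: val_inj; rewrite /= foldr_push_nil // word_reduced. Qed.

Lemma fg_mulV : left_inverse fg_one fg_inv fg_mul.
Proof.
move=> u; apply: val_inj; rewrite /= foldr_push_foldr ?word_reduced //=.
elim: (word u) (word_reduced u) => //= a s IH /andP[ras rs].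
rewrite rev_cons map_rcons -cats1 foldr_cat /=.
by rewrite eqxx IH.
Qed.

Lemma fg_mulrV : right_inverse fg_one fg_inv fg_mul.
Proof.
move=> u; have E := fg_mulV (fg_inv u).
by rewrite -[fg_mul u _]fg_mul1 -{1}E -fg_mulA [fg_mul (fg_inv u) _]fg_mulA
           fg_mulV fg_mul1 E.
Qed.

HB.instance Definition _ :=
  isGroup.Build free_group fg_mulA fg_mul1 fg_mulr1 fg_mulV fg_mulrV.

Definition fg_gen (k : 'I_e) : free_group := @FreeWord [:: (k, false)] isT.

Lemma fg_genV k : word (fg_gen k)^-1 = [:: (k, true)].
Proof. by []. Qed.

Lemma free_group_ind (P : free_group -> Prop) :
    P 1 -> (forall k w, P w -> P (fg_gen k * w)) ->
    (forall k w, P w -> P ((fg_gen k)^-1 * w)) ->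
  forall w, P w.
Proof.
move=> P1 Pg Pv [s]; elim: s => [|a s IH] rs.
  by rewrite (_ : FreeWord _ = 1) //; apply: val_inj.
have rs' : reduced s by case/andP: rs.
have E : push a s = a :: s.
  by case: s rs {IH rs'} => [|b s] //= /andP[/negPf->].
case: a rs E => k [] rs E.
  rewrite (_ : FreeWord _ = (fg_gen k)^-1 * FreeWord rs'); first exact/Pv/IH.
  by apply: val_inj; rewrite /= -E.
rewrite (_ : FreeWord _ = fg_gen k * FreeWord rs'); first exact/Pg/IH.
by apply: val_inj; rewrite /= -E.
Qed.

Section FreeHom.
Variables (G : groupType) (y : 'I_e -> G).

Definition eval_letter (a : letter) : G := if a.2 then (y a.1)^-1 else y a.1.

Definition free_hom (w : free_group) : G :=
  foldr (fun a g => eval_letter a * g) 1 (word w).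

Lemma eval_push a s :
  foldr (fun a g => eval_letter a * g) 1 (push a s) =
  eval_letter a * foldr (fun a g => eval_letter a * g) 1 s.
Proof.
case: s => [|b s] //=; case: (eqVneq a (inv_letter b)) => //= ->.
case: b => k b; rewrite /eval_letter /inv_letter /= mulgA.
by case: b; rewrite /= ?mulgV ?mulVg mul1g.
Qed.

Lemma free_hom_mul : {morph free_hom : u v / u * v}.
Proof.
move=> u v; rewrite /free_hom /=; elim: (word u) => [|a s IH] /=.
  by rewrite mul1g.
by rewrite eval_push IH mulgA.
Qed.

HB.instance Definition _ :=
  isMultiplicative.Build free_group G free_hom free_hom_mul.

Lemma free_hom_gen k : free_hom (fg_gen k) = y k.
Proof. exact: mulg1. Qed.

End FreeHom.

End FreeGroup.

Section Morph.
Variables (G H : groupType) (f : {multiplicative G -> H}).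

Lemma mhom1 : f 1 = 1.
Proof. by apply: (mulgI (f 1)); rewrite -gmulfM !mulg1. Qed.

Lemma mhomV x : f x^-1 = (f x)^-1.
Proof. by apply: (mulgI (f x)); rewrite -gmulfM !mulgV mhom1. Qed.

Lemma mhomJ x y : f (x ^ y) = f x ^ f y.
Proof. by rewrite /conjg !gmulfM mhomV. Qed.

Lemma mhomX x k : f (x ^+ k) = f x ^+ k.
Proof. by elim: k => [|k IH]; rewrite ?expg0 ?mhom1 // !expgS gmulfM IH. Qed.
End Morph.

Record nsubgroup (G : groupType) := NSubgroup {
  ns_mem :> G -> Prop;
  ns1 : ns_mem 1;
  nsM : forall x y, ns_mem x -> ns_mem y -> ns_mem (x * y);
  nsV : forall x, ns_mem x -> ns_mem x^-1;
  nsJ : forall x g, ns_mem x -> ns_mem (x ^ g)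
}.

Section Quotient.
Variables (G : groupType) (N : nsubgroup G).

Definition ns_rel : rel G := fun x y => `[< N (x^-1 * y) >].

Lemma ns_rel_equiv : equiv_class_of ns_rel.
Proof.
split=> [x|x y|y x z].
- by apply/asboolP; rewrite mulVg; apply: ns1.
- apply/asboolP/asboolP=> /nsV; first by rewrite invgM invgK.
  by rewrite invgM invgK.
- move=> /asboolP xy /asboolP yz; apply/asboolP.
  by have := nsM xy yz; rewrite mulgA mulgK.
Qed.

Canonical ns_equiv := EquivRelPack ns_rel_equiv.

Definition quot : Type := {eq_quot ns_equiv}%qT.

HB.instance Definition _ := Choice.on quot.

Definition quot_proj (x : G) : quot := (\pi_{eq_quot ns_equiv} x)%qT.

Lemma quot_projE x y : quot_proj x = quot_proj y <-> N (x^-1 * y).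
Proof.
split=> [/eqquotP/asboolP //|h].
by apply/eqquotP/asboolP.
Qed.

Notation rep := generic_quotient.repr.

Lemma quot_proj_surj (q : quot) : exists x, quot_proj x = q.
Proof. by exists (rep q); apply: reprK. Qed.

Definition quot_mul (q r : quot) : quot := quot_proj (rep q * rep r).
Definition quot_inv (q : quot) : quot := quot_proj (rep q)^-1.

Lemma quot_reprP x : N (x^-1 * rep (quot_proj x)).
Proof. by apply/quot_projE; rewrite [RHS]reprK. Qed.

Lemma quot_mulE x y : quot_mul (quot_proj x) (quot_proj y) = quot_proj (x * y).
Proof.
apply/esym/quot_projE; set a := rep _; set b := rep _.
have -> : (x * y)^-1 * (a * b) = (x^-1 * a) ^ y * (y^-1 * b).
  by rewrite /conjg invgM !mulgA mulgK.
by apply: nsM; [apply: nsJ|]; apply: quot_reprP.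
Qed.

Lemma quot_invE x : quot_inv (quot_proj x) = quot_proj x^-1.
Proof.
apply/quot_projE; rewrite invgK; set a := rep _.
rewrite (_ : a * x^-1 = (x^-1 * a) ^ x^-1); first exact/nsJ/quot_reprP.
by rewrite /conjg invgK !mulgA mulgV mul1g.
Qed.

Lemma quot_mulA : associative quot_mul.
Proof.
move=> q r s; have [x <-] := quot_proj_surj q; have [y <-] := quot_proj_surj r.
by have [z <-] := quot_proj_surj s; rewrite !quot_mulE mulgA.
Qed.

Lemma quot_mul1 : left_id (quot_proj 1) quot_mul.
Proof. by move=> q; have [x <-] := quot_proj_surj q; rewrite quot_mulE mul1g. Qed.

Lemma quot_mulr1 : right_id (quot_proj 1) quot_mul.
Proof. by move=> q; have [x <-] := quot_proj_surj q; rewrite quot_mulE mulg1. Qed.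

Lemma quot_mulV : left_inverse (quot_proj 1) quot_inv quot_mul.
Proof.
by move=> q; have [x <-] := quot_proj_surj q; rewrite quot_invE quot_mulE mulVg.
Qed.

Lemma quot_mulrV : right_inverse (quot_proj 1) quot_inv quot_mul.
Proof.
by move=> q; have [x <-] := quot_proj_surj q; rewrite quot_invE quot_mulE mulgV.
Qed.

HB.instance Definition _ :=
  isGroup.Build quot quot_mulA quot_mul1 quot_mulr1 quot_mulV quot_mulrV.

Lemma quot_projM : {morph quot_proj : x y / x * y}.
Proof. by move=> x y; apply/esym/quot_mulE. Qed.

HB.instance Definition _ := isMultiplicative.Build G quot quot_proj quot_projM.

Lemma quot_proj1 x : quot_proj x = 1 <-> N x.
Proof.
split=> [/esym/quot_projE|h]; first by rewrite invg1 mul1g.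
by apply/esym/quot_projE; rewrite invg1 mul1g.
Qed.

End Quotient.

Section Kernel.
Variables (G H : groupType) (f : {multiplicative G -> H}).

Definition kerN : nsubgroup G.
Proof.
exists (fun x => f x = 1).
- exact: mhom1.
- by move=> x y fx fy; rewrite gmulfM fx fy mulg1.
- by move=> x fx; rewrite mhomV fx invg1.
- by move=> x g fx; rewrite mhomJ fx conj1g.
Defined.

End Kernel.

Inductive generated (G : groupType) (S : G -> Prop) : G -> Prop :=
| gen_in x of S x : generated S x
| gen_1 : generated S 1
| gen_M x y of generated S x & generated S y : generated S (x * y)
| gen_V x of generated S x : generated S x^-1.

Lemma generatedJ (G : groupType) (S : G -> Prop) :
  (forall x g, S x -> S (x ^ g)) ->
  forall x g, generated S x -> generated S (x ^ g).
Proof.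
move=> SJ x g; elim=> {x} [x Sx||x y _ IHx _ IHy|x _ IH].
- exact/gen_in/SJ.
- by rewrite conj1g; apply: gen_1.
- by rewrite conjMg; apply: gen_M.
- by rewrite conjVg; apply: gen_V.
Qed.

Section CommPower.
Variables (G : groupType) (M : nsubgroup G) (p : nat).

Definition commutator_of (x : G) : Prop :=
  exists a b, [/\ M a, M b & x = [~ a, b]].

Definition power_of (x : G) : Prop := exists2 a, M a & x = a ^+ p.

Lemma commutator_ofJ x g : commutator_of x -> commutator_of (x ^ g).
Proof.
move=> [a [b [Ma Mb ->]]]; exists (a ^ g), (b ^ g).
by split; [apply: nsJ | apply: nsJ | rewrite conjRg].
Qed.

Lemma power_ofJ x g : power_of x -> power_of (x ^ g).
Proof.
by move=> [a Ma ->]; exists (a ^ g); [apply: nsJ | rewrite conjXg].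
Qed.

Definition comm_power : nsubgroup G.
Proof.
exists (fun x => exists u v,
  [/\ generated commutator_of u, generated power_of v & x = u * v]).
- by exists 1, 1; split; [apply: gen_1 | apply: gen_1 | rewrite mulg1].
- move=> _ _ [u1 [v1 [gu1 gv1 ->]]] [u2 [v2 [gu2 gv2 ->]]].
  exists (u1 * u2), (v1 ^ u2 * v2); split; first exact: gen_M.
    by apply: gen_M => //; apply: generatedJ => // *; apply: power_ofJ.
  by rewrite /conjg !mulgA mulgK.
- move=> _ [u [v [gu gv ->]]]; exists u^-1, (v^-1 ^ u^-1); split.
  + exact: gen_V.
  + by apply: generatedJ; [move=> *; apply: power_ofJ | apply: gen_V].
  + by rewrite /conjg invgK invgM !mulgA mulVg mul1g.
- move=> _ g [u [v [gu gv ->]]]; exists (u ^ g), (v ^ g); split.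
  + by apply: generatedJ => // *; apply: commutator_ofJ.
  + by apply: generatedJ => // *; apply: power_ofJ.
  + by rewrite conjMg.
Defined.

End CommPower.

(* Group extensions by Z_p H-modules. A finite-dimensional right Z_p H-module *)
(* is a representation rG of [set: gT] over 'F_p on row vectors; its m-fold   *)
(* direct power is 'M_(m, n), the copies being the rows and h acting by right *)
(* multiplication by rG h.                                                    *)

Record sdp (p : nat) (gT : finGroupType) (n : nat)
    (rG : mx_representation 'F_p [set: gT] n) (m : nat) : Type :=
  Sdp { sdp_grp : gT; sdp_mod : 'M['F_p]_(m, n) }.

Section Extensions.
Variables (p : nat) (gT : finGroupType) (n : nat).
Variable rG : mx_representation 'F_p [set: gT] n.

Lemma repr1T : rG 1 = 1%:M%R. Proof. exact: repr_mx1. Qed.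

Lemma reprMT g h : rG (g * h) = (rG g *m rG h)%R.
Proof. by rewrite repr_mxM ?inE. Qed.

Section SemiDirect.
Variable m : nat.

Notation sdp := (sdp rG m).
Notation Sdp := (Sdp rG).

Definition pair_of_sdp (u : sdp) := (sdp_grp u, sdp_mod u).
Definition sdp_of_pair u : sdp := Sdp u.1 u.2.
Lemma pair_of_sdpK : cancel pair_of_sdp sdp_of_pair. Proof. by case. Qed.
HB.instance Definition _ := Finite.copy sdp (can_type pair_of_sdpK).

Definition sdp_one : sdp := Sdp 1 0%R.
Definition sdp_mul (u v : sdp) : sdp :=
  Sdp (sdp_grp u * sdp_grp v) (sdp_mod u *m rG (sdp_grp v) + sdp_mod v)%R.
Definition sdp_inv (u : sdp) : sdp :=
  Sdp (sdp_grp u)^-1 (- (sdp_mod u *m rG (sdp_grp u)^-1%g))%R.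

Lemma sdp_mulA : associative sdp_mul.
Proof.
move=> [a u] [b v] [c w]; congr Sdp => /=; first by rewrite mulgA.
by rewrite reprMT mulmxDl mulmxA addrA.
Qed.

Lemma sdp_mul1 : left_id sdp_one sdp_mul.
Proof.
by move=> [a u]; congr Sdp => /=; rewrite ?mul1g // mul0mx add0r.
Qed.

Lemma sdp_mulV : left_inverse sdp_one sdp_inv sdp_mul.
Proof.
move=> [a u]; congr Sdp => /=; first by rewrite mulVg.
by rewrite mulNmx -mulmxA -reprMT mulVg repr1T mulmx1 addNr.
Qed.

HB.instance Definition _ := Finite_isGroup.Build sdp sdp_mulA sdp_mul1 sdp_mulV.

End SemiDirect.

Definition is_cocycle2 (c : gT -> gT -> 'rV['F_p]_n) : Prop :=
  forall g h k, (c g h *m rG k + c (g * h)%g k = c h k + c g (h * k)%g)%R.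

Definition is_coboundary2 (c : gT -> gT -> 'rV['F_p]_n) : Prop :=
  exists b : gT -> 'rV['F_p]_n,
    forall g h, (c g h = b g *m rG h + b h - b (g * h)%g)%R.

Record cocycle2 : Type :=
  Cocycle2 { cocycle_fun :> gT -> gT -> 'rV['F_p]_n;
             cocycleP : is_cocycle2 cocycle_fun }.

(* The classes of gamma_1, ..., gamma_d form a basis of Z^2 / B^2.            *)
Definition H2_basis d (gamma : 'I_d -> cocycle2) : Prop :=
  (forall a : 'I_d -> 'F_p,
     is_coboundary2 (fun g h => \sum_i a i *: gamma i g h)%R ->
     forall i, a i = 0%R)
  /\
  (forall c : cocycle2, exists a : 'I_d -> 'F_p,
     is_coboundary2 (fun g h => c g h - \sum_i a i *: gamma i g h)%R).

Record ext_group (gamma : cocycle2) : Type :=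
  Ext { ext_grp : gT; ext_mod : 'rV['F_p]_n }.

Section Extension.
Variable gamma : cocycle2.
Notation ext := (ext_group gamma).
Notation Ext := (Ext gamma).

Definition pair_of_ext (u : ext) := (ext_grp u, ext_mod u).
Definition ext_of_pair u : ext := Ext u.1 u.2.
Lemma pair_of_extK : cancel pair_of_ext ext_of_pair. Proof. by case. Qed.
HB.instance Definition _ := Finite.copy ext (can_type pair_of_extK).

(* gamma need not be normalised, so the identity is not (1, 0) in general.    *)
Definition ext_one : ext := Ext 1 (- gamma 1%g 1%g)%R.
Definition ext_mul (u v : ext) : ext :=
  Ext (ext_grp u * ext_grp v)
      (ext_mod u *m rG (ext_grp v) + ext_mod v + gamma (ext_grp u) (ext_grp v))%R.
Definition ext_inv (u : ext) : ext :=
  let g := ext_grp u in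
  Ext g^-1 (- (ext_mod u + gamma 1%g 1%g + gamma g^-1%g g)%R *m rG g^-1%g)%R.

Lemma gamma1l h : gamma 1 h = (gamma 1%g 1%g *m rG h)%R.
Proof.
by have := cocycleP gamma 1 1 h; rewrite !mul1g => /addIr.
Qed.

Lemma ext_mulA : associative ext_mul.
Proof.
move=> [a u] [b v] [c w]; congr Ext => /=; first by rewrite mulgA.
rewrite reprMT !mulmxDl mulmxA -!addrA; congr (_ + (_ + _))%R.
rewrite [RHS]addrCA; congr (_ + _)%R.
by rewrite (cocycleP gamma).
Qed.

Lemma ext_mul1 : left_id ext_one ext_mul.
Proof.
move=> [a u]; congr Ext => /=; first by rewrite mul1g.
by rewrite (gamma1l a) mulNmx addrAC addNr add0r.
Qed.

Lemma ext_mulV : left_inverse ext_one ext_inv ext_mul.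
Proof.
move=> [a u]; congr Ext => /=; first by rewrite mulVg.
rewrite -mulmxA -reprMT mulVg repr1T mulmx1.
by rewrite -addrA addrC addrAC opprD addrA; rewrite opprD addrAC addrA subrr add0r addrK.
Qed.

HB.instance Definition _ := Finite_isGroup.Build ext ext_mulA ext_mul1 ext_mulV.

Definition ext_proj (u : ext) : gT := ext_grp u.

Lemma ext_projM : {morph ext_proj : u v / u * v}.
Proof. by []. Qed.

HB.instance Definition _ := isMultiplicative.Build ext gT ext_proj ext_projM.

End Extension.

Section Covers.
Variables (e : nat) (psi : {multiplicative free_group e -> gT}).

(* For z in the m-fold power of the module, the j-th component of embed z     *)
(* maps x_j to (psi x_j, z) and x_k to (psi x_k, 0) for k != j.               *)
Section Embed.
Variables (m : nat) (z : 'M['F_p]_(m, n)).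

Definition embed_comp (j : 'I_e) : free_group e -> sdp rG m :=
  free_hom (fun k => Sdp rG (psi (fg_gen k)) (if k == j then z else 0%R)).

Definition embed (w : free_group e) : {ffun 'I_e -> sdp rG m} :=
  [ffun j => embed_comp j w].

Lemma embedM : {morph embed : u v / u * v}.
Proof.
by move=> u v; apply/ffunP=> j; rewrite !ffunE [LHS]free_hom_mul.
Qed.

HB.instance Definition _ := isMultiplicative.Build _ _ embed embedM.

End Embed.

Definition varrho (gamma : cocycle2) : free_group e -> ext_group gamma :=
  free_hom (fun k => Ext gamma (psi (fg_gen k)) 0%R).

Lemma varrho_proj gamma k :
  ext_proj (varrho gamma (fg_gen k)) = psi (fg_gen k).
Proof. by rewrite /varrho free_hom_gen. Qed.

Definition rho_cod (r d : nat) (gamma : 'I_d -> cocycle2) : Type :=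
  {ffun 'I_e -> sdp rG r} * {dffun forall i : 'I_d, ext_group (gamma i)}.

HB.instance Definition _ r d gamma := Group.on (@rho_cod r d gamma).

Definition rho r (z : 'M['F_p]_(r, n)) d (gamma : 'I_d -> cocycle2)
    (w : free_group e) : rho_cod r gamma :=
  (embed z w, [ffun i => varrho (gamma i) w]).

Lemma rhoM r z d gamma : {morph @rho r z d gamma : u v / u * v}.
Proof.
move=> u v; congr pair; first exact: embedM.
by apply/ffunP=> i; rewrite !ffunE [LHS]free_hom_mul.
Qed.

HB.instance Definition _ r z d gamma :=
  isMultiplicative.Build _ _ (@rho r z d gamma) (@rhoM r z d gamma).

End Covers.
End Extensions.

Section Homogeneous.
Variables (p : nat) (gT : finGroupType) (n : nat).
Variable rV : mx_representation 'F_p [set: gT] n.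
Variables (F : groupType) (psi : {multiplicative F -> gT}).

(* A Z_p H-module is presented as a subgroup A of a group Q that is a         *)
(* quotient pi : F -> Q, where psi w acts on A as conjugation by pi w; A is   *)
(* V-homogeneous when it is isomorphic to V^m for some m >= 0.                *)
Definition V_homogeneous (Q : groupType) (pi : F -> Q) (A : Q -> Prop) : Prop :=
  exists (m : nat) (f : 'M['F_p]_(m, n) -> Q),
    [/\ {morph f : u v / (u + v)%R >-> u * v},
        injective f,
        forall a, A a <-> exists v, f v = a
      & forall v w, f (v *m rV (psi w))%R = f v ^ pi w].

Section Radical.
Variables (Q : groupType) (pi : F -> Q) (A : nsubgroup Q).

(* When pi is onto, the submodules of A are the normal subgroups of Q         *)
(* contained in A.                                                            *)
Definition V_cosubmodule (B : nsubgroup Q) : Prop :=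
  (forall q, B q -> A q) /\
  V_homogeneous (fun w => quot_proj B (pi w))
                (fun q => exists2 a, A a & quot_proj B a = q).

(* V(A), as the intersection of the submodules B with A / B V-homogeneous;    *)
(* that it is itself such a B for A = M / M_p is Vrad_smallest below.         *)
Definition Vrad : nsubgroup Q.
Proof.
exists (fun q => A q /\ forall B, V_cosubmodule B -> B q).
- by split=> [|B _]; apply: ns1.
- move=> x y [Ax Bx] [Ay By]; split=> [|B hB]; apply: nsM => //.
    exact: Bx.
  exact: By.
- by move=> x [Ax Bx]; split=> [|B hB]; apply: nsV => //; apply: Bx.
- by move=> x g [Ax Bx]; split=> [|B hB]; apply: nsJ => //; apply: Bx.
Defined.

End Radical.
End Homogeneous.

(* r is the dimension of an absolutely simple constituent W / U of V, after   *)
(* extension of scalars to a splitting field L.                               *)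
Definition abs_simple_dim (p : nat) (gT : finGroupType) (n : nat)
    (rV : mx_representation 'F_p [set: gT] n) (r : nat) : Prop :=
  exists (L : fieldType) (iota : {rmorphism 'F_p -> L}),
    group_splitting_field L [set: gT] /\
    exists (U W : 'M[L]_n) (modU : mxmodule (map_repr iota rV) U)
           (modW : mxmodule (map_repr iota rV) W),
      [/\ (U <= W)%MS,
          mx_absolutely_irreducible (section_repr modU modW)
        & r = \rank (in_factmod U W)].

Definition cyclic_generator (p : nat) (gT : finGroupType) (n : nat)
    (rV : mx_representation 'F_p [set: gT] n) (r : nat)
    (z : 'M['F_p]_(r, n)) : Prop :=
  forall y : 'M['F_p]_(r, n), exists a : gT -> 'F_p,
    y = (\sum_h a h *: (z *m rV h))%R.

Section Hhat.
Variables (p : nat) (gT : finGroupType) (e : nat).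
Variable psi : {multiplicative free_group e -> gT}.

Definition Mp : nsubgroup (free_group e) := comm_power (kerN psi) p.

Definition Hhat_p : groupType := quot Mp.
Definition proj_p : {multiplicative free_group e -> Hhat_p} := @quot_proj _ Mp.

Lemma proj_p_surj (q : Hhat_p) : exists w, proj_p w = q.
Proof. exact: quot_proj_surj. Qed.

Definition M_over_Mp : nsubgroup Hhat_p.
Proof.
exists (fun q => exists2 w, psi w = 1 & proj_p w = q).
- by exists 1; rewrite mhom1.
- move=> _ _ [x px <-] [y py <-]; exists (x * y); last by rewrite gmulfM.
  by rewrite gmulfM px py mulg1.
- move=> _ [x px <-]; exists x^-1; last by rewrite mhomV.
  by rewrite mhomV px invg1.
- move=> _ g [x px <-]; have [y <-] := proj_p_surj g.
  exists (x ^ y); last by rewrite mhomJ.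
  by rewrite mhomJ px conj1g.
Defined.

Definition Psi_p : free_group e -> {ffun 'I_e -> sdp (regular_repr 'F_p [set: gT]) 1} :=
  embed (regular_repr 'F_p [set: gT]) psi (delta_mx 0%R (gring_index [set: gT] 1)).

HB.instance Definition _ := Multiplicative.on Psi_p.

Section Cover.
Variables (n : nat) (rV : mx_representation 'F_p [set: gT] n).

Definition Hhat_V : groupType := quot (Vrad rV psi proj_p M_over_Mp).
Definition proj_V : {multiplicative Hhat_p -> Hhat_V} := @quot_proj _ _.

End Cover.
End Hhat.

Section Identification.
Variables (p : nat) (gT : finGroupType) (e : nat).
Variable psi : {multiplicative free_group e -> gT}.
Notation F := (free_group e).
Notation nG := #|[set: gT]|.

Lemma ffM (I : finType) (G : groupType) (f g : {ffun I -> G}) i :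
  (f * g) i = f i * g i.
Proof. by rewrite ffunE. Qed.

Lemma ff1 (I : finType) (G : groupType) i : (1 : {ffun I -> G}) i = 1.
Proof. by rewrite ffunE. Qed.

Lemma embed_grp n (rG : mx_representation 'F_p [set: gT] n) m (z : 'M_(m, n)) w j :
  sdp_grp (embed rG psi z w j) = psi w.
Proof.
move: w; apply: free_group_ind => [|k w IH|k w IH].
- by rewrite mhom1 mhom1 ffunE.
- by rewrite gmulfM ffunE /= IH gmulfM ffunE /embed_comp free_hom_gen.
- by rewrite gmulfM ffunE /= IH gmulfM !mhomV ffunE /= ffunE /embed_comp free_hom_gen.
Qed.

Lemma Psi_p_grp w j : sdp_grp (Psi_p p psi w j) = psi w.
Proof. exact: embed_grp. Qed.

Lemma generated_sub (G : groupType) (S : G -> Prop) (N : nsubgroup G) x :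
  (forall y, S y -> N y) -> generated S x -> N x.
Proof.
move=> SN; elim=> {x} [x /SN //||x y _ Nx _ Ny|x _ Nx]; first exact: ns1.
  exact: nsM.
exact: nsV.
Qed.

Lemma Mp_ker (w : F) : Mp p psi w -> psi w = 1.
Proof.
move=> [u [v [gu gv ->]]]; apply: (nsM (n := kerN psi)).
  apply: generated_sub gu => _ [a [b [/= pa pb ->]]].
  by rewrite /commg /conjg !gmulfM !mhomV pa pb !invg1 !mulg1.
by apply: generated_sub gv => _ [a /= pa ->]; rewrite mhomX pa expg1n.
Qed.

Hypothesis p_pr : prime p.

Lemma mulrn_Fp (V : lmodType 'F_p) (v : V) : (v *+ p = 0)%R.
Proof. by rewrite -scaler_nat pchar_Fp_0 // scale0r. Qed.

Lemma ker_Psi_p_sub (w : F) : Mp p psi w -> Psi_p p psi w = 1.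
Proof.
have Mw a : psi a = 1 -> exists u, forall j, Psi_p p psi a j = Sdp _ 1 (u j).
  move=> pa; exists (fun j => sdp_mod (Psi_p p psi a j)) => j.
  by move: (Psi_p_grp a j); rewrite pa; case: (Psi_p _ _ _ _) => g u /= ->.
move=> [u [v [gu gv ->]]]; apply: (nsM (n := kerN (Psi_p p psi))).
  apply: generated_sub gu => _ [a [b [/= /Mw[ua Ea] /Mw[ub Eb] ->]]].
  rewrite /commg /conjg !gmulfM !mhomV mulgA -invgM.
  rewrite (_ : Psi_p p psi b * _ = Psi_p p psi a * Psi_p p psi b) ?mulVg //.
  apply/ffunP=> j; rewrite !ffM Ea Eb; congr Sdp => /=.
  by rewrite !repr1T !mulmx1 addrC.
apply: generated_sub gv => _ [a /= /Mw[ua Ea] ->].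
rewrite mhomX; apply/ffunP=> j; rewrite ff1.
have E k : (Psi_p p psi a ^+ k) j = Sdp _ 1 (ua j *+ k)%R.
  elim: k => [|k IH]; first by rewrite expg0 ff1.
  rewrite expgS ffM Ea IH; congr Sdp => /=; first by rewrite mulg1.
  by rewrite repr1T mulmx1 mulrS.
by rewrite E mulrn_Fp.
Qed.

Lemma M_over_Mp_comm x y : M_over_Mp p psi x -> M_over_Mp p psi y -> x * y = y * x.
Proof.
move=> [a pa <-] [b pb <-]; rewrite -!gmulfM; apply/quot_projE.
exists [~ b, a], 1; split; last by rewrite mulg1 /commg /conjg invgM !mulgA.
  by apply: gen_in; exists b, a.
exact: gen_1.
Qed.

Lemma M_over_Mp_exp x : M_over_Mp p psi x -> x ^+ p = 1.
Proof.
move=> [a pa <-]; rewrite -mhomX; apply/quot_proj1.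
exists 1, (a ^+ p); split; [exact: gen_1| |by rewrite mul1g].
by apply: gen_in; exists a.
Qed.

Record Mbar := MkMbar { mval : Hhat_p p psi; _ : `[< M_over_Mp p psi mval >] }.
HB.instance Definition _ := [isSub for mval].
HB.instance Definition _ := [Choice of Mbar by <:].

Lemma mvalP (x : Mbar) : M_over_Mp p psi (mval x).
Proof. by apply/asboolP; case: x. Qed.

Definition mbar x (h : M_over_Mp p psi x) : Mbar := MkMbar (asboolT h).
Definition mb0 := mbar (ns1 (M_over_Mp p psi)).
Definition mbD x y := mbar (nsM (mvalP x) (mvalP y)).
Definition mbN x := mbar (nsV (mvalP x)).

Lemma mbDA : associative mbD.
Proof. by move=> x y z; apply: val_inj; rewrite /= mulgA. Qed.
Lemma mbDC : commutative mbD.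
Proof. by move=> x y; apply: val_inj; apply: M_over_Mp_comm; apply: mvalP. Qed.
Lemma mb0D : left_id mb0 mbD.
Proof. by move=> x; apply: val_inj; rewrite /= mul1g. Qed.
Lemma mbND : left_inverse mb0 mbN mbD.
Proof. by move=> x; apply: val_inj; rewrite /= mulVg. Qed.
HB.instance Definition _ := GRing.isZmodule.Build Mbar mbDA mbDC mb0D mbND.

Lemma mvalX (x : Mbar) k : mval (x *+ k)%R = mval x ^+ k.
Proof. by elim: k => [|k IH] //; rewrite mulrS expgS -IH. Qed.

Lemma mbar_torsion (x : Mbar) : (x *+ p = 0)%R.
Proof. by apply: val_inj; rewrite /= mvalX M_over_Mp_exp //; apply: mvalP. Qed.

Lemma mbar_addFp (x : Mbar) (a b : 'F_p) : (x *+ (a + b)%R = x *+ a + x *+ b)%R.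
Proof.
rewrite (_ : (a + b)%R = (a + b) %% p :> nat); last first.
  rewrite /=; move: (nat_of_ord a) (nat_of_ord b) => i j.
  by rewrite Fp_cast.
rewrite -mulrnDr [in RHS](divn_eq (a + b) p) mulrnDr mulnC mulrnA.
by rewrite mbar_torsion mul0rn add0r.
Qed.

Hypothesis psi_surj : forall h, exists w, psi w = h.

Definition sect h : F := sval (cid (psi_surj h)).
Lemma sectK h : psi (sect h) = h. Proof. exact: (svalP (cid (psi_surj h))). Qed.

Definition tval (g : F) (h : gT) : F := sect (h * (psi g)^-1) * g * (sect h)^-1.
Lemma tvalP g h : M_over_Mp p psi (proj_p p psi (tval g h)).
Proof.
by exists (tval g h) => //; rewrite !gmulfM mhomV !sectK mulgVK mulgV.
Qed.
Definition tfun g h : Mbar := mbar (tvalP g h).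

Lemma tfunM g g' h : (tfun (g * g')%g h = tfun g (h * (psi g')^-1)%g + tfun g' h)%R.
Proof.
apply: val_inj; rewrite /= -gmulfM; congr (proj_p p psi _).
by rewrite /tval gmulfM invgM !mulgA mulgVK.
Qed.

Definition ract (t : gT -> Mbar) (u : 'rV['F_p]_nG) (h : gT) : Mbar :=
  (\sum_a t (h * a^-1)%g *+ (u 0 (gring_index [set: gT] a)))%R.

Lemma ractD t u v h : ract t (u + v)%R h = (ract t u h + ract t v h)%R.
Proof.
by rewrite -big_split; apply: eq_bigr => a _; rewrite mxE mbar_addFp.
Qed.

Lemma regular_coef (u : 'rV['F_p]_nG) b a :
  ((u *m regular_repr 'F_p [set: gT] b) 0 (gring_index [set: gT] a) =
   u 0 (gring_index [set: gT] (a * b^-1)%g))%R.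
Proof.
rewrite mxE (bigD1 (gring_index [set: gT] (a * b^-1)%g)) //= big1 => [|i ni].
  by rewrite addr0 /regular_mx mxE gring_indexK ?inE // mulgVK mxE !eqxx mulr1.
rewrite /regular_mx mxE mxE eqxx /=; case: eqP => [E|]; last by rewrite mulr0.
case/eqP: ni; apply: enum_val_inj.
have : enum_val (gring_index [set: gT] a) = enum_val i * b.
  by rewrite E gring_indexK ?inE.
by rewrite !gring_indexK ?inE // => ->; rewrite mulgK.
Qed.

Lemma ractJ t u b h :
  ract t (u *m regular_repr 'F_p [set: gT] b)%R h = ract t u (h * b^-1).
Proof.
rewrite /ract (reindex_inj (mulIg b)); apply: eq_bigr => a _.
by rewrite regular_coef mulgK invgM mulgA.
Qed.

Lemma ract1 t h : ract t (delta_mx 0%R (gring_index [set: gT] 1)) h = t h.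
Proof.
rewrite /ract (bigD1 1%g) //= big1 => [|a na].
  by rewrite addr0 mxE !eqxx invg1 mulg1 /= modn_small // Fp_cast ?prime_gt1.
rewrite mxE eqxx /=; case: eqP => // E; case/eqP: na.
have := congr1 enum_val E.
by rewrite !gring_indexK ?inE.
Qed.

Definition sfun g h : Mbar :=
  (\sum_j ract (tfun (fg_gen j)) (sdp_mod (Psi_p p psi g j)) h)%R.

Lemma sfunM g g' h : (sfun (g * g')%g h = sfun g (h * (psi g')^-1)%g + sfun g' h)%R.
Proof.
rewrite -big_split; apply: eq_bigr => j _.
by rewrite gmulfM ffM /= Psi_p_grp ractD ractJ.
Qed.

Lemma tfun_sfun g h : tfun g h = sfun g h.
Proof.
have cross1 f : (forall g g' h,
    f (g * g')%g h = f g (h * (psi g')^-1)%g + f g' h :> Mbar)%R ->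
    forall h, f 1 h = 0%R.
  move=> fM h'; have := fM 1 1 h'; rewrite mulg1 mhom1 invg1 mulg1.
  by rewrite -{1}[f 1 h']addr0 => /addrI.
have gen k h' : tfun (fg_gen k) h' = sfun (fg_gen k) h'.
  rewrite /sfun (bigD1 k) //= big1 => [|j nj].
    rewrite addr0 /Psi_p /embed ffunE /embed_comp free_hom_gen /= eqxx.
    by rewrite ract1.
  rewrite /Psi_p /embed ffunE /embed_comp free_hom_gen /= eq_sym (negPf nj).
  by rewrite /ract big1 // => a _; rewrite mxE mulr0n.
move: g h; apply: free_group_ind => [h|k w IH h|k w IH h].
- by rewrite !cross1 //; [apply: sfunM | apply: tfunM].
- by rewrite tfunM sfunM gen IH.
rewrite tfunM sfunM IH; congr (_ + _)%R; move: (h * _) => h'.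
apply: (addIr (tfun (fg_gen k) (h' * psi (fg_gen k)))).
have E f : (forall g g' h,
    f (g * g')%g h = f g (h * (psi g')^-1)%g + f g' h :> Mbar)%R ->
    (f (fg_gen k)^-1%g h' + f (fg_gen k) (h' * psi (fg_gen k))%g = 0)%R.
  move=> fM; rewrite -(cross1 f fM (h' * psi (fg_gen k))) -(mulVg (fg_gen k)).
  by rewrite fM mulgK.
by rewrite (E tfun tfunM) gen (E sfun sfunM).
Qed.

Lemma ker_Psi_p (w : F) : Psi_p p psi w = 1 <-> Mp p psi w.
Proof.
split=> [Pw|]; last exact: ker_Psi_p_sub.
have pw : psi w = 1.
  case: (posnP e) => [e0|e_gt0]; last first.
    by rewrite -(Psi_p_grp w (Ordinal e_gt0)) Pw ff1.
  have E1 : w = 1 by move: w {Pw}; apply: free_group_ind => // -[k lk];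
    exfalso; rewrite e0 in lk.
  by rewrite E1 mhom1.
have T0 : tfun w 1 = 0%R.
  rewrite tfun_sfun /sfun big1 // => j _; rewrite Pw ff1 /= /ract big1 // => a _.
  by rewrite mxE mulr0n.
have /quot_proj1 := congr1 mval T0.
rewrite /tval pw mul1g invg1.
move/(nsJ (sect 1)); rewrite /conjg !mulgA mulgVK mulVg mul1g //.
Qed.

End Identification.

(* The isomorphism Psi_p(F) -> F / M_p inverse to the one induced by Psi_p;   *)
(* extended by 1 outside Psi_p(F).                                            *)
Definition ident (p : nat) (gT : finGroupType) (e : nat)
    (psi : {multiplicative free_group e -> gT})
    (u : {ffun 'I_e -> sdp (regular_repr 'F_p [set: gT]) 1}) : Hhat_p p psi :=
  if pselect (exists w, Psi_p p psi w = u) is left ex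
  then proj_p p psi (sval (cid ex)) else 1.

Lemma ident_Psi_p p (gT : finGroupType) e (psi : {multiplicative free_group e -> gT})
    (p_pr : prime p) (psi_surj : forall h, exists w, psi w = h) w :
  ident psi (Psi_p p psi w) = proj_p p psi w.
Proof.
rewrite /ident; case: pselect => [ex|[]]; last by exists w.
case: (cid ex) => v /= Ev; apply/quot_projE/(ker_Psi_p p_pr psi_surj).
by rewrite gmulfM mhomV /= Ev mulVg.
Qed.

Definition nsubI (G : groupType) (B C : nsubgroup G) : nsubgroup G.
Proof.
exists (fun x => B x /\ C x).
- by split; apply: ns1.
- by move=> x y [? ?] [? ?]; split; apply: nsM.
- by move=> x [? ?]; split; apply: nsV.
- by move=> x g [? ?]; split; apply: nsJ.
Defined.

Section Smallest.
Variables (p : nat) (gT : finGroupType) (n : nat).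
Variable rV : mx_representation 'F_p [set: gT] n.
Hypotheses (p_pr : prime p) (irrV : mx_irreducible rV).
Variables (F : groupType) (psi : {multiplicative F -> gT}).
Hypothesis psi_surj : forall h, exists w, psi w = h.
Variables (Q : groupType) (pi : F -> Q) (A : nsubgroup Q).

Definition presents (B : Q -> Prop) m (phi : Q -> 'M['F_p]_(m, n)) : Prop :=
  [/\ forall a b, A a -> A b -> phi (a * b) = (phi a + phi b)%R,
      forall a w, A a -> phi (a ^ pi w) = (phi a *m rV (psi w))%R
    & forall a, A a -> phi a = 0%R <-> B a].

Lemma presentsN B m (phi : Q -> 'M_(m, n)) a b : presents B phi ->
  A a -> A b -> phi a = phi b -> B (a^-1 * b).
Proof.
move=> [phiD _ phi0] Aa Ab E; have Ai := nsV Aa.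
apply/phi0; first exact: nsM.
apply: (addrI (phi a)); rewrite -phiD //; last exact: nsM.
by rewrite mulKVg addr0 E.
Qed.

Lemma cosub_presents (B : nsubgroup Q) : V_cosubmodule rV psi pi A B ->
  exists m (phi : Q -> 'M_(m, n)), presents B phi /\
    forall v, exists2 a, A a & phi a = v.
Proof.
move=> [BA [m [f [fD f_inj f_im fJ]]]]; exists m.
pose phi q := if pselect (exists v, f v = quot_proj B q) is left ex
              then sval (cid ex) else 0%R.
have phiP a : A a -> f (phi a) = quot_proj B a.
  move=> Aa; rewrite /phi; case: pselect => [ex|[]]; first by case: (cid ex).
  by apply/f_im; exists a.
have f0 : f 0%R = 1 by apply: (mulgI (f 0%R)); rewrite -fD addr0 mulg1.
exists phi; split; first split.
- by move=> a b Aa Ab; apply: f_inj; rewrite fD !phiP ?gmulfM //; apply: nsM.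
- move=> a w Aa; apply: f_inj; rewrite fJ !phiP ?mhomJ //; exact: nsJ.
- move=> a Aa; split=> [E|/quot_proj1 E].
    by apply/quot_proj1; rewrite -phiP // E f0.
  by apply: f_inj; rewrite phiP // E f0.
move=> v; have /f_im[a Aa E] : exists u, f u = f v by exists v.
by exists a => //; apply: f_inj; rewrite phiP.
Qed.

Lemma presents_cosub (B : nsubgroup Q) m (phi : Q -> 'M_(m, n)) :
    (forall q, B q -> A q) -> presents B phi ->
    (forall v, exists2 a, A a & phi a = v) -> V_cosubmodule rV psi pi A B.
Proof.
move=> BA prB onto; split=> //; have [phiD phiJ phi0] := prB.
pose g v := s2val (cid2 (onto v)).
have gA v : A (g v) by apply: (s2valP (cid2 (onto v))).
have gK v : phi (g v) = v by apply: (s2valP' (cid2 (onto v))).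
have E a b : A a -> A b -> phi a = phi b -> quot_proj B a = quot_proj B b.
  by move=> Aa Ab ab; apply/quot_projE; apply: (presentsN prB).
exists m, (fun v => quot_proj B (g v)); split.
- move=> u v; rewrite -gmulfM; apply: E => //; first exact: nsM.
  by rewrite phiD // !gK.
- move=> u v /quot_projE /phi0 uv; rewrite -(gK u) -(gK v).
  rewrite -[g v](mulKVg (g u)) phiD //; last by apply: nsM => //; apply: nsV.
  rewrite uv ?addr0 //; by apply: nsM => //; apply: nsV.
- move=> q; split=> [[a Aa <-]|[v <-]]; last by exists (g v).
  by exists (phi a); apply: E => //; rewrite gK.
move=> v w; rewrite -mhomJ; apply: E => //; first exact: nsJ.
by rewrite phiJ // !gK.
Qed.

(* A submodule of V^k projects isomorphically to the copies outside a         *)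
(* maximal set of copies of V that it meets trivially.                        *)
Lemma presents_onto (B : Q -> Prop) k (phi : Q -> 'M_(k, n)) :
  presents B phi ->
  exists m (phi' : Q -> 'M_(m, n)), presents B phi' /\
    forall v, exists2 a, A a & phi' a = v.
Proof.
move=> [phiD phiJ phi0].
pose supp (S : {set 'I_k}) (y : 'M['F_p]_(k, n)) := forall i, i \notin S -> row i y = 0%R.
pose P (S : {set 'I_k}) := `[< forall a, A a -> supp S (phi a) -> phi a = 0%R >].
have P0 : P set0.
  apply/asboolP=> a Aa s; apply/row_matrixP=> i; rewrite row0; apply: s.
  by rewrite inE.
case: (@maxset_exists _ P _ P0) => S /maxsetP[/asboolP PS maxS] _.
have A1 : A 1 by apply: ns1.
have phi1 : phi 1 = 0%R.
  by apply: (addrI (phi 1)); rewrite -phiD // mulg1 addr0.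
have act (c : gT -> 'F_p) a (S' : {set 'I_k}) : A a -> supp S' (phi a) ->
    exists2 b, A b & phi b = (\sum_h c h *: (phi a *m rV h))%R.
  move=> Aa _.
  elim/big_rec: _ => [|h y _ [b Ab <-]]; first by exists 1.
  have [w <-] := psi_surj h.
  have aX j : phi ((a ^ pi w) ^+ j) = (phi a *m rV (psi w) *+ j)%R /\ A ((a ^ pi w) ^+ j).
    elim: j => [|j [IH AJ]]; first by rewrite expg0.
    rewrite expgS phiD ?IH ?phiJ ?mulrS //; last exact: nsJ.
    by split=> //; apply: nsM => //; apply: nsJ.
  have [aXj AX] := aX (c (psi w)).
  exists ((a ^ pi w) ^+ (c (psi w)) * b); first exact: nsM.
  by rewrite phiD // aXj -scaler_nat natr_Zp.
have one i : i \notin S -> forall v : 'rV_n, exists b, [/\ A b, row i (phi b) = v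
    & forall j, j \notin S -> j != i -> row j (phi b) = 0%R].
  move=> Si v.
  have : ~ P (i |: S).
    move=> Pi; have := maxS _ Pi (subsetUr _ _) => E.
    by move: Si; rewrite -E !inE eqxx.
  move=> nP; have : ~ (forall a, A a -> supp (i |: S) (phi a) -> phi a = 0%R).
    by move=> h; apply: nP; apply/asboolP.
  move=> /existsNP[a /not_implyP[Aa /not_implyP[sa na]]].
  have ri : row i (phi a) != 0%R.
    apply: contra_notN na => /eqP r0; apply: PS => // j Sj.
    case: (eqVneq j i) => [->//|ji]; apply: sa; by rewrite !inE negb_or ji.
  have [_ _ simpV] := irrV.
  have sub := simpV _ (cyclic_mx_module rV (row i (phi a))) (submx1 _).
  have nz : cyclic_mx rV (row i (phi a)) != 0%R.
    apply: contraNneq ri => c0; rewrite -submx0 -c0; exact: cyclic_mx_id.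
  have /cyclic_mxP[B' /envelop_mxP[c ->] ->] : (v <= cyclic_mx rV (row i (phi a)))%MS.
    exact: submx_trans (submx1 v) (sub nz).
  have [b Ab Eb] := act c a _ Aa sa.
  exists b; split=> //.
    rewrite Eb linear_sum mulmx_sumr /=; apply: eq_big => [h|h _]; first by rewrite inE.
    by rewrite linearZ /= row_mul scalemxAr.
  move=> j Sj ji; rewrite Eb linear_sum big1 // => h _.
  by rewrite linearZ /= row_mul sa ?mul0mx ?scaler0 // !inE negb_or ji.
pose T := [set i | i \notin S].
exists #|T|, (fun a => rowsub enum_val (phi a)); split; first split.
- by move=> a b Aa Ab; rewrite phiD //; apply/matrixP=> i j; rewrite !mxE.
- move=> a w Aa; rewrite phiJ //; apply/row_matrixP=> i.
  by rewrite row_mul !row_rowsub row_mul.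
- move=> a Aa; rewrite -phi0 //; split=> [E|->]; last first.
    by apply/matrixP=> i j; rewrite !mxE.
  apply: PS => // i Si; have Ti : i \in T by rewrite inE.
  by rewrite -(enum_rankK_in Ti Ti) -row_rowsub E row0.
move=> v.
have sumP (r : seq 'I_#|T|) : uniq r -> exists2 a, A a & forall i,
    row (enum_val i) (phi a) = if i \in r then row i v else 0%R.
  elim: r => [_|i r IH /= /andP[ir /IH[a Aa Ea]]].
    by exists 1 => // i; rewrite phi1 row0.
  have Si (j : 'I_#|T|) : enum_val j \notin S by have := enum_valP j; rewrite inE.
  have [b [Ab Eb E0]] := one _ (Si i) (row i v).
  exists (a * b); first exact: nsM.
  move=> j; rewrite phiD // linearD /= Ea inE; case: (eqVneq j i) => [->|ji] /=.
    by rewrite (negPf ir) add0r.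
  by rewrite E0 ?addr0 // (inj_eq enum_val_inj).
have [a Aa Ea] := sumP _ (enum_uniq 'I_#|T|).
exists a => //; apply/row_matrixP=> i; rewrite row_rowsub Ea.
by rewrite mem_enum.
Qed.

Lemma Vrad_cosub bound :
  (forall B, V_cosubmodule rV psi pi A B -> forall m (phi : Q -> 'M_(m, n)),
     presents B phi -> (forall v, exists2 a, A a & phi a = v) -> m <= bound) ->
  V_cosubmodule rV psi pi A (Vrad rV psi pi A).
Proof.
move=> bnd.
pose good m := `[< exists (B : nsubgroup Q) (phi : Q -> 'M_(m, n)),
  [/\ forall q, B q -> A q, presents B phi & forall v, exists2 a, A a & phi a = v] >].
have ex : exists m, good m.
  have : presents A (fun _ => 0%R : 'M['F_p]_(0, n)).
    by split=> // [a b _ _|a w _]; rewrite ?addr0 ?mul0mx.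
  move=> /presents_onto[m [phi [pr onto]]]; exists m; apply/asboolP.
  by exists A, phi; split.
have good_le m : good m -> m <= bound.
  move=> /asboolP[B [phi [BA pr onto]]].
  exact: (bnd B (presents_cosub BA pr onto) _ _ pr onto).
case: (ex_maxnP ex good_le) => m /asboolP[B0 [phi0 [B0A pr0 onto0]]] maxm.
suff VB q : A q -> Vrad rV psi pi A q <-> B0 q.
  apply: (@presents_cosub _ m phi0) => //; first by move=> q [].
  by have [pD pJ pK] := pr0; split=> // a Aa; rewrite pK // VB.
move=> Aq; split=> [[_ /(_ B0)]|B0q]; first by apply; apply: presents_cosub pr0 onto0.
split=> // B cB; have [BA _] := cB; have [m' [phi1 [pr1 _]]] := cosub_presents cB.
have [pD0 pJ0 pK0] := pr0; have [pD1 pJ1 pK1] := pr1.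
pose C := nsubI B B0.
have prC : presents C (fun a => col_mx (phi1 a) (phi0 a)).
  split=> [a b Aa Ab|a w Aa|a Aa].
  - by rewrite pD0 // pD1 // add_col_mx.
  - by rewrite pJ0 // pJ1 // mul_col_mx.
  rewrite /C /= -pK0 // -pK1 //; split=> [E|[-> ->]]; last by rewrite col_mx0.
  by apply: eq_col_mx; rewrite E col_mx0.
have [l [phi [prl ontol]]] := presents_onto prC.
have lm : l <= m.
  by apply: maxm; apply/asboolP; exists C, phi; split=> // x [_ /B0A].
pose g v := s2val (cid2 (ontol v)).
have gA v : A (g v) by apply: (s2valP (cid2 (ontol v))).
have gK v : phi (g v) = v by apply: (s2valP' (cid2 (ontol v))).
have E0 a b : A a -> A b -> phi a = phi b -> phi0 a = phi0 b.
  move=> Aa Ab /(presentsN prl Aa Ab)[_ ab].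
  rewrite -[b](mulKVg a) pD0 //; last by apply: nsM => //; apply: nsV.
  by move/pK0: ab => -> //; [rewrite addr0 | apply: nsM => //; apply: nsV].
have surj y : exists v, phi0 (g v) = y.
  have [a Aa <-] := onto0 y; exists (phi a).
  by apply: E0; rewrite ?gK.
pose s y := sval (cid (surj y)).
have sK : cancel s (fun v => phi0 (g v)) by move=> y; apply: (svalP (cid (surj y))).
have s_inj := can_inj sK.
have card_le : #|{: 'M['F_p]_(l, n)}| <= #|{: 'M['F_p]_(m, n)}|.
  by rewrite !card_mx leq_pexp2l ?leq_mul2r ?lm ?orbT // card_Fp // prime_gt0.
have [s' sK' s'K] := inj_card_bij s_inj card_le.
have inj v v' : phi0 (g v) = phi0 (g v') -> v = v'.
  by rewrite -(s'K v) -(s'K v') !sK => ->.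
have [phiD _ phiC] := prl.
have phi1' : phi 1 = 0%R.
  by apply/phiC; [apply: ns1 | apply: (ns1 C)].
have /phiC [] // : phi q = 0%R.
apply: inj; rewrite (E0 (g (phi q)) q) ?gK //.
rewrite (E0 (g 0%R) 1) ?gK //; last exact: ns1.
have -> : phi0 q = 0%R by apply/pK0.
by apply/esym/pK0; apply: ns1.
Qed.

End Smallest.

Lemma Vrad_smallest p (gT : finGroupType) n (rV : mx_representation 'F_p [set: gT] n)
    (p_pr : prime p) (irrV : mx_irreducible rV)
    e (psi : {multiplicative free_group e -> gT})
    (psi_surj : forall h, exists w, psi w = h) :
  let cosub := V_cosubmodule rV psi (proj_p p psi) (M_over_Mp p psi) in
  let VM := Vrad rV psi (proj_p p psi) (M_over_Mp p psi) in
  cosub VM /\ forall B, cosub B -> forall q, VM q -> B q.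
Proof.
split=> [|B cB q [_]]; last exact.
apply: (Vrad_cosub p_pr irrV psi_surj
  (bound := #|{: {ffun 'I_e -> sdp (regular_repr 'F_p [set: gT]) 1}}|)).
move=> B _ m phi pr onto.
pose w v := sval (cid (proj_p_surj (s2val (cid2 (onto v))))).
have wK v : phi (proj_p p psi (w v)) = v.
  rewrite (svalP (cid (proj_p_surj (s2val (cid2 (onto v)))))).
  exact: (s2valP' (cid2 (onto v))).
have inj : injective (fun v => Psi_p p psi (w v)).
  move=> u v /= E; rewrite -(wK u) -(wK v) -!(ident_Psi_p p_pr psi_surj).
  by rewrite E.
apply: leq_trans (leq_card _ inj).
rewrite card_mx card_Fp //.
have n0 : 0 < n.
  case: (posnP n) => // n0; case: irrV => _ /eqP[].
  by apply/matrixP=> i; exfalso; case: i => i; rewrite n0.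
apply: leq_trans (ltnW (ltn_expl _ (prime_gt1 p_pr))).
by rewrite leq_pmulr.
Qed.

(* Main.v *)
(* Write M = ker psi. An element of M lies over V(M / M_p) iff every            *)
(* F-homomorphism phi : M -> V kills it, so ker (eta o Psi_p) is the common    *)
(* kernel of these phi, and it has to be compared with ker rho.                *)
(* Each coordinate of rho, restricted to M, is (up to a constant) such a phi.  *)
(* Conversely, phi transgresses to a class in H^2(H, V), which is a            *)
(* combination of the gamma_i; subtracting the corresponding coordinates of    *)
(* the varrho_i leaves the restriction to M of a derivation F -> V.            *)
(* Derivations are determined by their values on the generators, so they are   *)
(* all recovered from Psi_{V,e} as soon as z can be sent to any vector of V by *)
(* an H-map V^r -> V, i.e. as soon as the rows of z span V over D = End_H(V).  *)
(* These rows are D-independent because z is a cyclic generator, and r is at   *)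
(* least dim_D V: by density the group algebra acts on V through an algebra    *)
(* containing a unital matrix algebra of size dim_D V, which still acts on     *)
(* every constituent of V after extension of scalars.                          *)

Require Import Defs.
From HB Require Import structures.
From mathcomp Require Import all_boot all_order all_algebra all_fingroup.
From mathcomp Require Import mxrepresentation.
From mathcomp Require Import boolp.
From mathcomp Require Import ring.

Set Implicit Arguments.
Unset Strict Implicit.
Unset Printing Implicit Defensive.

Import GroupScope.

(** Put [M = ker psi]. The radical of [M / M_p] is cut out by the equivariant homomorphisms [M -> V]
    ([Vrad_kernel_hom]). These are controlled by the exactness of
    [Der(F, V) -> Hom_F(M, V) -> H^2(H, V)]: modulo the coordinates [varrho_i], which account for
    [H^2(H, V)], each of them is the restriction of a derivation ([transgression_derivation]). Over
    [D = End_H(V)] the rows of [z] span [V] ([cyclic_generator_span]), so every derivation is a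
    combination of the coordinates of [Psi_{V,e}]. Hence [ker rho] kills all these homomorphisms
    ([kernel_hom_eq0]); [rho_ker] adds the converse and [mhom_factor] turns equal kernels into an
    isomorphism of images. *)

(** * Linear algebra of V over its endomorphism ring D *)

Section EndoBasis.
Import GRing.Theory.
Local Open Scope ring_scope.
Variables (K : fieldType) (gT : finGroupType) (G : {group gT}) (n : nat).
Variable rG : mx_representation K G n.

(** A linear combination of the rows of [B] over the ring [D] of module endomorphisms, which acts on
    row vectors from the right; [endo_free] and [endo_span] are independence and spanning over
    [D]. *)
Definition endo_comb m (B : 'M[K]_(m, n)) (N : 'I_m -> 'M[K]_n) : 'rV[K]_n :=
  \sum_i row i B *m N i.

Definition endo_family m (N : 'I_m -> 'M[K]_n) := forall i, centgmx rG (N i).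

Definition endo_free m (B : 'M[K]_(m, n)) :=
  forall N, endo_family N -> endo_comb B N = 0 -> forall i, N i = 0.

Definition endo_span m (B : 'M[K]_(m, n)) :=
  forall v, exists2 N, endo_family N & endo_comb B N = v.

Lemma centgmx_linear a f g : centgmx rG f -> centgmx rG g -> centgmx rG (a *: f + g).
Proof.
move=> /centgmxP cf /centgmxP cg; apply/centgmxP=> x Gx.
by rewrite mulmxDl mulmxDr -scalemxAl -scalemxAr cf ?cg.
Qed.

Lemma centgmx0 : centgmx rG 0.
Proof. by apply/centgmxP=> x _; rewrite mulmx0 mul0mx. Qed.

Lemma centgmx_scalar a : centgmx rG a%:M.
Proof. by apply/centgmxP=> x _; rewrite scalar_mxC. Qed.

Lemma centgmx_mul f g : centgmx rG f -> centgmx rG g -> centgmx rG (f *m g).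
Proof.
move=> /centgmxP cf /centgmxP cg; apply/centgmxP=> x Gx.
by rewrite -mulmxA cg // !mulmxA cf.
Qed.

Lemma centgmx_inv f : f \in unitmx -> centgmx rG f -> centgmx rG (invmx f).
Proof.
move=> uf /centgmxP cf; apply/centgmxP=> x Gx.
by rewrite -[LHS](mulmxK uf) -[_ *m _ *m f]mulmxA -cf // mulmxA mulVmx // mul1mx.
Qed.

Lemma centgmx_sum (I : Type) (s : seq I) (a : I -> K) (f : I -> 'M[K]_n) :
  (forall i, centgmx rG (f i)) -> centgmx rG (\sum_(i <- s) a i *: f i).
Proof.
move=> cf; elim/big_rec: _ => [|i g _]; first exact: centgmx0.
exact: centgmx_linear.
Qed.

Lemma endo_combD m (B : 'M_(m, n)) a N N' :
  endo_comb B (fun i => a *: N i + N' i) = a *: endo_comb B N + endo_comb B N'.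
Proof.
rewrite scaler_sumr -big_split; apply: eq_bigr => i _ /=.
by rewrite mulmxDr -scalemxAr.
Qed.

Lemma endo_comb_mulr m (B : 'M_(m, n)) N f :
  endo_comb B (fun i => N i *m f) = endo_comb B N *m f.
Proof. by rewrite mulmx_suml; apply: eq_bigr => i _; rewrite mulmxA. Qed.

Lemma endo_comb_delta m (B : 'M_(m, n)) j f :
  endo_comb B (fun i => if i == j then f else 0) = row j B *m f.
Proof.
rewrite /endo_comb (bigD1 j) //= eqxx big1 ?addr0 // => i /negPf->.
by rewrite mulmx0.
Qed.

Lemma endo_family_delta m (j : 'I_m) f :
  centgmx rG f -> endo_family (fun i => if i == j then f else 0).
Proof. by move=> cf i; case: eqP => // _; apply: centgmx0. Qed.

Lemma endo_free_eq m (B : 'M_(m, n)) N N' : endo_free B ->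
  endo_family N -> endo_family N' -> endo_comb B N = endo_comb B N' -> N =1 N'.
Proof.
move=> freeB cN cN' E i; apply/eqP; rewrite -subr_eq0 addrC -scaleN1r; apply/eqP.
apply: (freeB (fun i => -1 *: N' i + N i)) => [k|]; first exact: centgmx_linear.
by rewrite endo_combD scaleN1r E addNr.
Qed.

(** Scalar matrices lie in [D], so independence over [D] implies independence over [K]. *)
Lemma endo_free_leq m (B : 'M_(m, n)) : (0 < n)%N -> endo_free B -> (m <= n)%N.
Proof.
move=> n0 freeB; suff /eqP <- : row_free B by apply: rank_leq_col.
apply/row_freeP/row_freeP/inj_row_free => u uB0.
apply/rowP=> i; rewrite mxE.
have := freeB (fun i => (u 0 i)%:M) (fun i => centgmx_scalar _).
rewrite /endo_comb (eq_bigr (fun i => u 0 i *: row i B)); last first.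
  by move=> k _; rewrite mul_mx_scalar.
move=> /(_ _ i) E.
have {E} /matrixP/(_ (Ordinal n0) (Ordinal n0)) : (u 0 i)%:M = 0 :> 'M_n.
  by apply: E; rewrite -mulmx_sum_row.
by rewrite !mxE eqxx mulr1n.
Qed.

Hypothesis irrG : mx_irreducible rG.

(** By Schur's lemma a nonzero coefficient of [v] is invertible; dividing by it would express [v]
    through the rows of [B]. *)
Lemma endo_free_extend m (B : 'M_(m, n)) v : endo_free B ->
  (forall N, endo_family N -> endo_comb B N <> v) -> endo_free (col_mx B v).
Proof.
move=> freeB nv N cN; rewrite /endo_comb big_split_ord /= big_ord1.
under eq_bigr => i _ do rewrite rowKu.
rewrite rowKd row_id => /eqP; rewrite addrC addr_eq0 => /eqP E.
have N0 : N (rshift m 0) = 0.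
  apply/eqP; apply: contraT => nz; have uN := mx_Schur irrG (cN _) nz.
  case: (nv (fun i => (-1)%:M *m N (lshift 1 i) *m invmx (N (rshift m 0)))).
    move=> i; apply: centgmx_mul; last exact: centgmx_inv.
    by apply: centgmx_mul => //; apply: centgmx_scalar.
  rewrite endo_comb_mulr -[RHS](mulmxK uN) E; congr (_ *m _).
  rewrite /endo_comb -sumrN; apply: eq_bigr => i _.
  by rewrite mul_scalar_mx scaleN1r mulmxN.
move: E; rewrite N0 mulmx0 => /eqP; rewrite eq_sym oppr_eq0 => /eqP E i.
case: (split_ordP i) => j ->; last by rewrite ord1.
by apply: (freeB (fun j => N (lshift 1 j))).
Qed.

Lemma endo_basis_exists : exists m (B : 'M_(m, n)), endo_free B /\ endo_span B.
Proof.
have n0 : (0 < n)%N by case/mx_irrP: irrG.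
pose good m := `[< exists B : 'M_(m, n), endo_free B >].
have ex : exists m, good m by exists 0; apply/asboolP; exists 0 => N _ _ [].
have bnd m : good m -> (m <= n)%N by move=> /asboolP[B /(endo_free_leq n0)].
case: (ex_maxnP ex bnd) => m /asboolP[B freeB] maxm; exists m, B; split=> // v.
apply: contrapT => nv; suff : (m + 1 <= m)%N by rewrite addn1 ltnn.
apply: maxm; apply/asboolP; exists (col_mx B v); apply: endo_free_extend => // N cN E.
by apply: nv; exists N.
Qed.

(* [E i j] is the map linear over the endomorphisms that sends the i-th basis  *)
(* vector to the j-th and kills the others (matrices act on the right).        *)
Lemma envelop_matrix_units m (B : 'M_(m, n)) : endo_free B -> endo_span B ->
  exists E : 'I_m -> 'I_m -> 'M_n,
  [/\ forall i j, (E i j \in enveloping_algebra_mx rG)%MS,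
      \sum_i E i i = 1%:M
    & forall i j k l, E i j *m E k l = if j == k then E i l else 0].
Proof.
move=> freeB spanB.
pose coef v := s2val (cid2 (spanB v)).
have coefC v : endo_family (coef v) := s2valP (cid2 (spanB v)).
have coefK v : endo_comb B (coef v) = v := s2valP' (cid2 (spanB v)).
(* Row [l] is the image of the [l]-th standard vector: its [i]-th coordinate over [D], applied to
   [row j B]. *)
pose E i j := \matrix_l (row j B *m coef (row l 1%:M) i).
have EP i j N : endo_family N -> endo_comb B N *m E i j = row j B *m N i.
  move=> cN; set v := endo_comb B N; rewrite mulmx_sum_row.
  under eq_bigr => l _ do rewrite rowK scalemxAr.
  rewrite -mulmx_sumr; congr (_ *m _).
  apply: (endo_free_eq (N := fun k => \sum_l v 0 l *: coef (row l 1%:M) k) freeB) => //.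
    by move=> k; apply: centgmx_sum => l; apply: coefC.
  rewrite /endo_comb; under eq_bigr => k _ do rewrite mulmx_sumr.
  rewrite exchange_big -[RHS]mulmx1 mulmx_sum_row; apply: eq_bigr => l _ /=.
  rewrite -[X in _ = _ *: X]coefK scaler_sumr; apply: eq_bigr => k _.
  by rewrite scalemxAr.
have Erow i j v : v *m E i j = row j B *m coef v i by rewrite -{1}(coefK v) EP.
exists E; split=> [i j||i j k l].
(* By density it suffices that [E i j] commutes with each [f] in [D], which is its linearity over
   [D]. *)
- apply: (submx_trans _ (mx_Jacobson_density irrG)); apply/cent_mxP=> f cf.
  have {}cf : centgmx rG f.
    move/cent_mxP in cf; apply/centgmxP=> x Gx.
    by rewrite cf ?envelop_mx_id.
  apply/row_matrixP=> l; rewrite !rowE !mulmxA; set v := delta_mx 0 l.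
  rewrite -[in LHS](coefK v) -endo_comb_mulr EP; last first.
    by move=> k; apply: centgmx_mul => //; apply: coefC.
  by rewrite Erow mulmxA.
- apply/row_matrixP=> l; rewrite !rowE mulmx_sumr mulmx1 -[RHS]coefK.
  by apply: eq_bigr => i _; rewrite Erow.
apply/row_matrixP=> q; rewrite !rowE mulmxA [_ *m E i j]Erow
  -(endo_comb_delta B j) EP; last first.
  by apply: endo_family_delta; apply: coefC.
by rewrite (eq_sym k); case: (j == k); rewrite ?Erow ?mulmx0.
Qed.

End EndoBasis.

(** * The rows of a cyclic generator span V over D *)

Section ConstituentRank.
Import GRing.Theory.
Local Open Scope ring_scope.

(** Take [x] in [W] outside [U]. As the [E i i] sum to 1, some [x *m E i i] is outside [U]. The
    vectors [x *m E i j] are then independent modulo [U]: applying [E j i] to a relation isolates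
    its [j]-th coefficient times [x *m E i i]. *)
Lemma matrix_units_rank (L : fieldType) n s (E : 'I_s -> 'I_s -> 'M[L]_n)
    (U W : 'M[L]_n) :
    \sum_i E i i = 1%:M ->
    (forall i j k l, E i j *m E k l = if j == k then E i l else 0) ->
    (forall i j, (U *m E i j <= U)%MS) -> (forall i j, (W *m E i j <= W)%MS) ->
    ~~ (W <= U)%MS -> (s <= \rank (in_factmod U W))%N.
Proof.
move=> sumE mulE UE WE /row_subPn[q]; set x := row q W => xU.
have [i xi] : exists i, ~~ (x *m E i i <= U)%MS.
  apply/existsP; apply: contraR xU => /existsPn h; rewrite -[x]mulmx1 -sumE mulmx_sumr.
  by apply: summx_sub => i _; move: (h i); rewrite negbK.
pose Y := \matrix_j (x *m E i j).
have YW : (Y <= W)%MS.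
  apply/row_subP=> j; rewrite rowK; apply: submx_trans (WE i j).
  by apply: submxMr; apply: row_sub.
apply: leq_trans (mxrankS (submxMr _ YW)).
suff /eqP-> : row_free (in_factmod U Y) by [].
apply: inj_row_free => v; rewrite -[in_factmod U Y]/(Y *m _) mulmxA => /eqP.
rewrite -/(in_factmod U (v *m Y)) in_factmod_eq0 => vY.
apply/rowP=> j; rewrite mxE; apply/eqP; apply: contraNT xi => vj.
have : (v *m Y *m E j i <= U)%MS by apply: submx_trans (submxMr _ vY) (UE j i).
rewrite [v *m Y]mulmx_sum_row mulmx_suml (bigD1 j) //= big1 ?addr0 => [|k kj].
  rewrite rowK -scalemxAl -mulmxA mulE eqxx => /(scalemx_sub (v 0 j)^-1).
  by rewrite scalerA mulVf // scale1r.
by rewrite rowK -scalemxAl -mulmxA mulE (negPf kj) mulmx0 scaler0.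
Qed.

(* The matrix units of the enveloping algebra survive extension of scalars and *)
(* act on every section.                                                       *)
Lemma endo_basis_section (K L : fieldType) (iota : {rmorphism K -> L})
    (gT : finGroupType) (G : {group gT}) n (rG : mx_representation K G n) m
    (B : 'M[K]_(m, n)) (U W : 'M[L]_n) :
    mx_irreducible rG -> endo_free rG B -> endo_span rG B ->
    mxmodule (map_repr iota rG) U -> mxmodule (map_repr iota rG) W ->
  ~~ (W <= U)%MS -> (m <= \rank (in_factmod U W))%N.
Proof.
move=> irrG freeB spanB modU modW.
have [E [E_env sumE mulE]] := envelop_matrix_units irrG freeB spanB.
have stable (X : 'M_n) i j : mxmodule (map_repr iota rG) X ->
    (X *m map_mx iota (E i j) <= X)%MS.
  move=> modX; apply: mxmodule_envelop modX _ (submx_refl _).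
  by rewrite -map_enveloping_algebra_mx -map_mxvec map_submx.
apply: (@matrix_units_rank _ _ _ (fun i j => map_mx iota (E i j)))
  => [|i j k l|i j|i j].
- by rewrite -(map_mx1 iota) -sumE raddf_sum.
- by rewrite -map_mxM mulE; case: ifP; rewrite ?map_mx0.
- exact: stable.
exact: stable.
Qed.

Variables (p : nat) (gT : finGroupType) (n : nat).
Variable rV : mx_representation 'F_p [set: gT] n.
Hypothesis irrV : mx_irreducible rV.

(** For fixed [N] the map [y |-> endo_comb y N] from [V^r] to [V] is H-linear, so it vanishes once
    it kills the generator [z]. *)
Lemma cyclic_generator_free r (z : 'M_(r, n)) :
  cyclic_generator rV z -> endo_free rV z.
Proof.
move=> gen N cN E0 i; apply/row_matrixP=> l; rewrite row0 rowE.
have E y : endo_comb y N = 0.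
  have [a ->] := gen y; rewrite /endo_comb.
  under eq_bigr => k _ do rewrite linear_sum mulmx_suml.
  rewrite exchange_big big1 //= => h _.
  under eq_bigr => k _.
    rewrite linearZ /= -scalemxAl row_mul -mulmxA.
    have /centgmxP/(_ h) <- := cN k; last by rewrite inE.
    rewrite mulmxA.
    over.
  by rewrite -scaler_sumr -mulmx_suml -/(endo_comb z N) E0 mul0mx scaler0.
rewrite -[RHS](E (delta_mx i l)) /endo_comb (bigD1 i) //= big1 => [|k ki].
  by rewrite addr0; congr (_ *m _); apply/rowP=> j; rewrite !mxE !eqxx.
rewrite -[RHS](mul0mx _ (N k)); congr (_ *m _).
by apply/rowP=> j; rewrite !mxE (negPf ki).
Qed.

(** By counting: with [m] the dimension of [V] over [D] and [m <= r], the injection [D^r -> V] given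
    by [z] is onto because [|V| <= |D|^m <= |D|^r]. *)
Lemma cyclic_generator_span r (z : 'M_(r, n)) : abs_simple_dim rV r ->
  cyclic_generator rV z -> endo_span rV z.
Proof.
move=> [L [iota [_ [U [W [modU [modW [UW absI rE]]]]]]]] gen.
have freez := cyclic_generator_free gen.
have [m [B [freeB spanB]]] := endo_basis_exists irrV.
have mr : (m <= r)%N.
  rewrite rE; apply: (endo_basis_section irrV freeB spanB modU modW).
  rewrite -in_factmod_eq0 -mxrank_eq0 -lt0n.
  by case/andP: absI => + _; rewrite mxrank_gen.
pose D := {N : 'M['F_p]_n | centgmx rV N}.
pose comb k (C : 'M_(k, n)) (N : {ffun 'I_k -> D}) := endo_comb C (fun i => val (N i)).
have DC k (N : {ffun 'I_k -> D}) : endo_family rV (fun i => val (N i)).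
  by move=> i; apply: valP.
have ex k (N : 'I_k -> 'M_n) : endo_family rV N ->
    exists N' : {ffun 'I_k -> D}, N =1 (fun i => val (N' i)).
  by move=> cN; exists [ffun i => exist _ (N i) (cN i)] => i; rewrite ffunE.
have inj_z : injective (comb r z).
  move=> N N' /(endo_free_eq freez (DC _ N) (DC _ N')) E; apply/ffunP=> i.
  exact/val_inj/E.
have le_m : (#|{: 'rV['F_p]_n}| <= #|{: {ffun 'I_m -> D}}|)%N.
  have surj v : exists N, comb m B N = v.
    have [N /ex[N' E] <-] := spanB v; exists N'; apply: eq_bigr => i _.
    by rewrite E.
  have can v : comb m B (sval (cid (surj v))) = v by apply: (svalP (cid (surj v))).
  exact: leq_card (can_inj can).
have D0 : (0 < #|{: D}|)%N by apply/card_gt0P; exists (exist _ 0 (centgmx0 rV)).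
have le_r : (#|{: 'rV['F_p]_n}| <= #|{: {ffun 'I_r -> D}}|)%N.
  by apply: leq_trans le_m _; rewrite !card_ffun !card_ord leq_pexp2l.
have [g _ gK] := inj_card_bij inj_z le_r.
by move=> v; exists (fun i => val (g v i)); [exact: DC | exact: gK].
Qed.

End ConstituentRank.

(** * Equivariant homomorphisms from ker psi to V, and the radical *)

Section KernelHom.
Import GRing.Theory.
Variables (p : nat) (gT : finGroupType) (n : nat).
Variable rV : mx_representation 'F_p [set: gT] n.
Hypotheses (p_pr : prime p) (irrV : mx_irreducible rV).
Variables (e : nat) (psi : {multiplicative free_group e -> gT}).
Hypothesis psi_surj : forall h, exists w, psi w = h.
Notation F := (free_group e).
Notation proj := (proj_p p psi).

(** [phi] is total on [F], but its values outside [ker psi] are unconstrained. *)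
Definition kernel_hom (phi : F -> 'rV['F_p]_n) : Prop :=
  (forall a b, psi a = 1 -> psi b = 1 -> phi (a * b) = (phi a + phi b)%R) /\
  (forall a w, psi a = 1 -> phi (a ^ w) = (phi a *m rV (psi w))%R).

Section Hom.
Variables (phi : F -> 'rV['F_p]_n) (homP : kernel_hom phi).

Lemma kernel_homM a b : psi a = 1 -> psi b = 1 -> phi (a * b) = (phi a + phi b)%R.
Proof. exact: homP.1. Qed.

Lemma kernel_homJ a w : psi a = 1 -> phi (a ^ w) = (phi a *m rV (psi w))%R.
Proof. exact: homP.2. Qed.

Lemma kernel_hom1 : phi 1 = 0%R.
Proof.
by apply: (addrI (phi 1)); rewrite -kernel_homM ?mhom1 // mulg1 addr0.
Qed.

Lemma kernel_homV a : psi a = 1 -> phi a^-1 = (- phi a)%R.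
Proof.
move=> pa; apply: (addrI (phi a)).
by rewrite -kernel_homM ?mhomV ?pa ?invg1 // mulgV kernel_hom1 subrr.
Qed.

Lemma kernel_homX a k : psi a = 1 -> phi (a ^+ k) = (phi a *+ k)%R.
Proof.
move=> pa; elim: k => [|k IH]; first by rewrite expg0 kernel_hom1.
by rewrite expgS kernel_homM ?mhomX ?pa ?expg1n // IH mulrS.
Qed.

Definition kernel_hom_ns : nsubgroup F.
Proof.
exists (fun a => psi a = 1 /\ phi a = 0%R).
- by rewrite mhom1 kernel_hom1.
- by move=> a b [pa ha] [pb hb]; rewrite gmulfM kernel_homM // pa pb ha hb mulg1 addr0.
- by move=> a [pa ha]; rewrite mhomV kernel_homV // pa ha invg1 oppr0.
- by move=> a w [pa ha]; rewrite mhomJ kernel_homJ // pa ha conj1g mul0mx.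
Defined.

(** [V] is abelian of exponent [p] and [ker psi] acts trivially on it. *)
Lemma kernel_hom_Mp a : Mp p psi a -> kernel_hom_ns a.
Proof.
move=> [u [v [gu gv ->]]]; apply: (nsM (n := kernel_hom_ns)).
  apply: generated_sub gu => _ [x [y [/= px py ->]]].
  have pxV : psi x^-1 = 1 by rewrite mhomV px invg1.
  have pxy : psi (x ^ y) = 1 by rewrite mhomJ px conj1g.
  rewrite /commg gmulfM pxV pxy mulg1 kernel_homM // kernel_homV // kernel_homJ //.
  by rewrite py repr_mx1 mulmx1 addNr.
apply: generated_sub gv => _ [x /= px ->].
by rewrite mhomX px expg1n kernel_homX // mulrn_Fp.
Qed.

Lemma kernel_hom_proj a b : psi a = 1 -> proj a = proj b -> psi b = 1 /\ phi b = phi a.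
Proof.
move=> pa /quot_projE /kernel_hom_Mp[pab hab].
by rewrite -(mulKVg a b) gmulfM kernel_homM // pab hab pa mulg1 addr0.
Qed.

Definition kernel_hom_ker : nsubgroup (Hhat_p p psi).
Proof.
exists (fun q => exists2 a, kernel_hom_ns a & proj a = q).
- by exists 1; [apply: ns1 | rewrite mhom1].
- move=> _ _ [a ha <-] [b hb <-]; exists (a * b); first exact: nsM.
  by rewrite gmulfM.
- by move=> _ [a ha <-]; exists a^-1; [apply: nsV | rewrite mhomV].
- move=> _ g [a ha <-]; have [w <-] := proj_p_surj g.
  by exists (a ^ w); [apply: nsJ | rewrite mhomJ].
Defined.

(** The quotient by the kernel of [phi] embeds in [V], and [presents_onto] makes a submodule of a
    homogeneous module homogeneous. *)
Lemma kernel_hom_cosub :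
  V_cosubmodule rV psi proj (M_over_Mp p psi) kernel_hom_ker.
Proof.
pose f (q : Hhat_p p psi) := phi (sval (cid (proj_p_surj q))).
have fE a : psi a = 1 -> f (proj a) = phi a.
  move=> pa; rewrite /f; case: (cid _) => b /= E.
  by have [] := kernel_hom_proj pa (esym E).
have [|m [g [prg onto]]] := @presents_onto _ _ _ _ irrV _ psi psi_surj _ proj
    (M_over_Mp p psi) kernel_hom_ker 1 f.
  split.
  - move=> _ _ [a pa <-] [b pb <-]; rewrite -gmulfM !fE ?kernel_homM //.
    by rewrite gmulfM pa pb mulg1.
  - move=> _ w [a pa <-]; rewrite -mhomJ !fE ?kernel_homJ //.
    by rewrite mhomJ pa conj1g.
  - move=> _ [a pa <-]; rewrite fE //; split=> [ha|[b [pb hb] E]].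
      by exists a.
    by have [_ ->] := kernel_hom_proj pb E.
apply: presents_cosub prg onto => _ [a [pa _] <-].
by exists a.
Qed.

End Hom.

(** Kernels of homomorphisms to [V] have homogeneous quotient; conversely, a quotient isomorphic to
    [V^m] is separated by its [m] coordinate maps to [V]. *)
Lemma Vrad_kernel_hom w : psi w = 1 ->
  Vrad rV psi proj (M_over_Mp p psi) (proj w) <->
  (forall phi, kernel_hom phi -> phi w = 0%R).
Proof.
move=> pw; split=> [[_ radw] phi homP|homw].
  have [a [pa ha] E] := radw _ (kernel_hom_cosub homP).
  by have [_ ->] := kernel_hom_proj homP pa E.
split=> [|B cB]; first by exists w.
have [m [f [[fD fJ f0] _]]] := cosub_presents cB.
have Mproj a : psi a = 1 -> M_over_Mp p psi (proj a) by exists a.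
apply/f0; first exact: Mproj.
apply/row_matrixP=> i; rewrite row0; apply: (homw (fun a => row i (f (proj a)))).
split=> [a b pa pb|a v pa].
  by rewrite gmulfM fD ?linearD //; apply: Mproj.
by rewrite mhomJ fJ ?row_mul //; apply: Mproj.
Qed.

(** * Derivations and the coordinates of rho *)

Definition derivation m (delta : F -> 'M['F_p]_(m, n)) : Prop :=
  forall u v, delta (u * v) = (delta u *m rV (psi v) + delta v)%R.

Lemma derivation1 m (delta : F -> 'M_(m, n)) : derivation delta -> delta 1 = 0%R.
Proof.
move=> D; apply: (addIr (delta 1)).
by rewrite -[RHS]/(0 + _)%R add0r -{3}(mulg1 1) D mhom1 repr_mx1 mulmx1.
Qed.

Lemma derivation_eq m (delta delta' : F -> 'M_(m, n)) :
    derivation delta -> derivation delta' ->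
    (forall k, delta (fg_gen k) = delta' (fg_gen k)) ->
  delta =1 delta'.
Proof.
move=> D D' E.
have EV k : delta (fg_gen k)^-1 = delta' (fg_gen k)^-1.
  have := derivation1 D; have := derivation1 D'; rewrite -(mulgV (fg_gen k)) D D' -E.
  by move=> <- /addrI.
apply: free_group_ind => [|k w IH|k w IH]; first by rewrite !derivation1.
  by rewrite D D' E IH.
by rewrite D D' EV IH.
Qed.

Lemma embed_derivation m (z : 'M_(m, n)) j :
  derivation (fun w => sdp_mod (embed rV psi z w j)).
Proof. by move=> u v; rewrite gmulfM ffM /= embed_grp. Qed.

(** For equivariance, expand [delta] on both sides of [a * w = w * a ^ w]; [a] and [a ^ w] act
    trivially. *)
Lemma derivation_kernel_hom m (delta : F -> 'M_(m, n)) i :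
  derivation delta -> kernel_hom (fun w => row i (delta w)).
Proof.
move=> D; split=> [a b pa pb|a w pa].
  by rewrite D pb repr_mx1 mulmx1 linearD.
rewrite -row_mul; congr row; have := D w (a ^ w); rewrite -conjgC D.
by rewrite mhomJ pa conj1g repr_mx1 mulmx1 addrC => /addrI.
Qed.

Lemma embed_gen m (z : 'M_(m, n)) j k :
  sdp_mod (embed rV psi z (fg_gen k) j) = if k == j then z else 0%R.
Proof. by rewrite ffunE /embed_comp free_hom_gen. Qed.

Lemma varrho_grp (gamma : cocycle2 rV) w : ext_grp (varrho psi gamma w) = psi w.
Proof.
rewrite -/(ext_proj _); move: w.
apply: free_group_ind => [|k w IH|k w IH]; first by rewrite /varrho !mhom1.
  by rewrite [varrho _ _ _]free_hom_mul ext_projM IH varrho_proj gmulfM.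
apply: (mulgI (psi (fg_gen k))); rewrite -{1}(varrho_proj _ gamma) -ext_projM.
by rewrite -[varrho _ _ _ * _]free_hom_mul -gmulfM !mulKVg IH.
Qed.

Lemma varrho_modM (gamma : cocycle2 rV) u v :
  ext_mod (varrho psi gamma (u * v)) =
  (ext_mod (varrho psi gamma u) *m rV (psi v) + ext_mod (varrho psi gamma v)
   + gamma (psi u) (psi v))%R.
Proof. by rewrite [varrho _ _ (u * v)]free_hom_mul /= !varrho_grp. Qed.

Lemma varrho_mod1 (gamma : cocycle2 rV) :
  ext_mod (varrho psi gamma 1) = (- gamma 1%g 1%g)%R.
Proof. by rewrite /varrho mhom1. Qed.

Lemma cocycle2_1r (gamma : cocycle2 rV) h : gamma h 1 = gamma 1 1.
Proof.
have := cocycleP gamma h 1 1.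
by rewrite !mulg1 repr_mx1 mulmx1 => /addIr.
Qed.

(** The constant compensates for the identity of [ext_group gamma] being [(1, - gamma 1 1)]. *)
Lemma varrho_kernel_hom (gamma : cocycle2 rV) :
  kernel_hom (fun w => ext_mod (varrho psi gamma w) + gamma 1%g 1%g)%R.
Proof.
split=> [a b pa pb|a w pa].
  rewrite varrho_modM pa pb repr_mx1 mulmx1 !addrA; congr (_ + _)%R.
  by rewrite addrAC.
have pc : psi (a ^ w) = 1 by rewrite mhomJ pa conj1g.
move: (a ^ w) pc (conjgC a w) => c pc /(congr1 (fun x => ext_mod (varrho psi gamma x))).
rewrite !varrho_modM pa pc repr_mx1 mulmx1 gamma1l cocycle2_1r => E.
apply: (addIr (ext_mod (varrho psi gamma w))).
by rewrite mulmxDl [RHS]addrAC E [LHS]addrC addrA.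
Qed.

(** * Transgression to the second cohomology group *)

Section Transgression.
Variables (phi : F -> 'rV['F_p]_n) (homP : kernel_hom phi).

Let s h : F := sval (cid (psi_surj h)).

Let psi_s h : psi (s h) = h.
Proof. exact: (svalP (cid (psi_surj h))). Qed.

(** The factor set of the section [s], which is not normalised: [s 1] may differ from 1. *)
Let m g h := (s (g * h))^-1 * (s g * s h).

Let psi_m g h : psi (m g h) = 1.
Proof. by rewrite !gmulfM mhomV !psi_s mulVg. Qed.

Let sM g h : s g * s h = s (g * h) * m g h.
Proof. by rewrite mulKVg. Qed.

(** Both sides are [phi] of the element obtained by multiplying [s g * s h * s k] on the left by the
    inverse of [s (g * h * k)]. *)
Lemma transgression_cocycle : is_cocycle2 rV (fun g h => phi (m g h)).
Proof.
move=> g h k; rewrite -{1}(psi_s k) -kernel_homJ // addrC [RHS]addrC.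
rewrite -!kernel_homM //; last by rewrite mhomJ psi_m conj1g.
congr phi; apply: (mulgI (s (g * (h * k)))).
rewrite [RHS]mulgA -sM -[RHS]mulgA -sM mulgA [g * (h * k)]mulgA -sM.
by rewrite -[s _ * _ * _]mulgA -conjgC mulgA -sM mulgA.
Qed.

(* [phi ((s (psi w))^-1 * w)] extends [phi] to [F] up to a constant; it fails  *)
(* to be a derivation exactly by the cocycle above.                            *)
Lemma transgression_derivation d (gamma : 'I_d -> cocycle2 rV) :
  H2_basis gamma ->
  exists delta a (b : gT -> 'rV_n), derivation delta /\
    forall w, phi ((s (psi w))^-1 * w) =
      (delta w + \sum_i a i *: ext_mod (varrho psi (gamma i) w) - b (psi w))%R.
Proof.
move=> [_ /(_ (Cocycle2 transgression_cocycle))[a [b /= cob]]].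
pose f w := phi ((s (psi w))^-1 * w).
have psi_f w : psi ((s (psi w))^-1 * w) = 1 by rewrite gmulfM mhomV psi_s mulVg.
have fM u v : f (u * v) = (f u *m rV (psi v) + f v + phi (m (psi u) (psi v)))%R.
  rewrite [RHS]addrC -[in rV _](psi_s (psi v)) -(kernel_homJ homP) // /f.
  have pJ : psi (((s (psi u))^-1 * u) ^ s (psi v)) = 1 by rewrite mhomJ psi_f conj1g.
  rewrite -!(kernel_homM homP) //; last by rewrite gmulfM pJ psi_f mulg1.
  rewrite gmulfM.
  congr phi; apply: (mulgI (s (psi u * psi v))).
  rewrite mulKVg [RHS]mulgA -sM -[RHS]mulgA [s (psi v) * _]mulgA -conjgC !mulgA.
  by rewrite mulgV mul1g mulgK.
(* The sum removes the [gamma i] from the defect of [f], and adding [b] cancels the remaining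
   coboundary. *)
exists (fun w => f w - \sum_i a i *: ext_mod (varrho psi (gamma i) w)
  + b (psi w))%R, a, b.
split=> [u v|w]; last by rewrite addrAC addrK subrK.
rewrite fM gmulfM.
have -> : (\sum_i a i *: ext_mod (varrho psi (gamma i) (u * v)%g) =
    (\sum_i a i *: ext_mod (varrho psi (gamma i) u)) *m rV (psi v)
  + \sum_i a i *: ext_mod (varrho psi (gamma i) v)
  + \sum_i a i *: gamma i (psi u) (psi v))%R.
  rewrite mulmx_suml -!big_split; apply: eq_bigr => i _ /=.
  by rewrite varrho_modM !scalerDr scalemxAl.
rewrite mulmxDl mulmxBl -[phi _](subrK (\sum_i a i *: gamma i (psi u) (psi v))%R) cob.
move: (b _) (b _) (f v) (b _ *m _)%R ((\sum_i _) *m _)%R (f u *m _)%R.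
move: (\sum_i a i *: ext_mod _)%R (\sum_i a i *: gamma _ _ _)%R => *.
by apply/rowP=> i; rewrite !mxE; ring.
Qed.

Lemma kernel_hom_eq0 d (gamma : 'I_d -> cocycle2 rV) r (z : 'M_(r, n)) w :
    H2_basis gamma -> endo_span rV z ->
    psi w = 1 -> (forall j, sdp_mod (embed rV psi z w j) = 0%R) ->
    (forall i, varrho psi (gamma i) w = 1) ->
  phi w = 0%R.
Proof.
move=> basis span pw Dw muw.
have [delta [a [b [derD E]]]] := transgression_derivation basis.
have delta0 : delta w = 0%R.
  (* Coefficients that send [z] to [delta (fg_gen k)]: applied to the coordinates of [embed], they
     give a derivation agreeing with [delta] on generators. *)
  pose N k := s2val (cid2 (span (delta (fg_gen k)))).
  have NC k : endo_family rV (N k) := s2valP (cid2 (span (delta (fg_gen k)))).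
  have NE k : endo_comb z (N k) = delta (fg_gen k) :=
    s2valP' (cid2 (span (delta (fg_gen k)))).
  have der' : derivation
      (fun u => \sum_k endo_comb (sdp_mod (embed rV psi z u k)) (N k))%R.
    move=> u v; rewrite mulmx_suml -big_split; apply: eq_bigr => k _ /=.
    rewrite (embed_derivation z k) /endo_comb mulmx_suml -big_split.
    apply: eq_bigr => i _ /=; rewrite linearD /= mulmxDl row_mul -!mulmxA.
    by have /centgmxP -> := NC k i; rewrite ?inE.
  rewrite (derivation_eq derD der') => [|k].
    by rewrite big1 // => k _; rewrite Dw /endo_comb big1 // => i _;
      rewrite row0 mul0mx.
  rewrite (bigD1 k) //= big1 => [|j jk]; rewrite embed_gen.
    by rewrite eqxx addr0 NE.
  rewrite eq_sym (negPf jk) /endo_comb big1 // => i _; by rewrite row0 mul0mx.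
have Ew := E w; have E1 := E 1.
have h1 : psi ((s (psi 1))^-1 * 1) = 1 by rewrite gmulfM mhomV psi_s mhom1 mulg1 invg1.
(* Comparing [w] with 1 cancels [b 1], the constants of the [varrho] and the unnormalised [s 1]. *)
have : phi ((s (psi 1))^-1 * w) = phi ((s (psi 1))^-1 * 1).
  rewrite E1 mhom1 -{1}pw Ew pw delta0 (derivation1 derD); congr (_ + _ - _)%R.
  by apply: eq_bigr => i _; rewrite muw varrho_mod1.
rewrite -{1}[_^-1]mulg1 (kernel_homM homP) // => /eqP.
by rewrite -subr_eq0 addrAC subrr add0r => /eqP.
Qed.

End Transgression.
End KernelHom.

(** * The kernel and image of rho *)

Lemma mhom_factor (G Q R : groupType) (pi : {multiplicative G -> Q})
    (f : {multiplicative G -> R}) :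
    (forall q, exists w, pi w = q) -> (forall w, f w = 1 <-> pi w = 1) ->
  exists g : {multiplicative Q -> R}, injective g /\ forall w, g (pi w) = f w.
Proof.
move=> pi_surj ker.
have f_eq w v : f w = f v <-> pi w = pi v.
  have E (S : groupType) (h : {multiplicative G -> S}) : h w = h v <-> h (w^-1 * v) = 1.
    rewrite gmulfM mhomV; split=> [->|/(congr1 (mul (h w)))]; first exact: mulVg.
    by rewrite mulKVg mulg1.
  by rewrite !E.
pose g q := f (sval (cid (pi_surj q))).
have gE w : g (pi w) = f w by apply/f_eq; apply: (svalP (cid (pi_surj (pi w)))).
have gM : {morph g : q q' / q * q'}.
  move=> q q'; have [w <-] := pi_surj q; have [v <-] := pi_surj q'.
  by rewrite -gmulfM !gE gmulfM.
pose g' : {multiplicative Q -> R} := HB.pack g (isMultiplicative.Build _ _ g gM).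
exists g'; split=> // q q'; have [w <-] := pi_surj q; have [v <-] := pi_surj q'.
by rewrite /= !gE => /f_eq.
Qed.

(** One inclusion is [kernel_hom_eq0]; for the other, the module components of all coordinates of
    [rho] are, up to constants and row by row, homomorphisms killed by the radical. *)
Lemma rho_ker p (p_pr : prime p) (gT : finGroupType) n
    (rV : mx_representation 'F_p [set: gT] n) (V_simple : mx_irreducible rV)
    e (psi : {multiplicative free_group e -> gT})
    (psi_surj : forall h, exists w, psi w = h)
    d (gamma : 'I_d -> cocycle2 rV) (gamma_basis : H2_basis gamma)
    r (z : 'M['F_p]_(r, n)) (z_span : endo_span rV z) w :
  rho psi z gamma w = 1 <-> proj_V psi rV (proj_p p psi w) = 1.
Proof.
have psi1 : rho psi z gamma w = 1 -> psi w = 1.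
  (* For [e = 0] there is no coordinate from which to read [psi w], but then [F] is trivial. *)
  move=> /(congr1 fst) /= E; case: (posnP e) => [e0|e_gt0].
    suff -> : w = 1 by rewrite mhom1.
    by apply: val_inj; case: (w) => [[|[k b] s]] //= _;
      have := ltn_ord k; rewrite {2}e0 ltn0.
  by rewrite -(embed_grp psi rV z w (Ordinal e_gt0)) E ff1.
split=> [rho1|/quot_proj1 rad].
  have pw := psi1 rho1.
  apply/quot_proj1/(Vrad_kernel_hom p_pr V_simple psi_surj) => // phi homP.
  apply: (kernel_hom_eq0 psi_surj homP gamma_basis z_span pw) => [j|i].
    by have /(congr1 fst) /= -> := rho1; rewrite ff1.
  by have /(congr1 snd) /= /ffunP/(_ i) := rho1; rewrite !ffunE.
have pw : psi w = 1.
  have [[a pa /quot_projE aw] _] := rad.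
  by rewrite -(mulKVg a w) gmulfM pa (Mp_ker aw) mulg1.
have homs := (Vrad_kernel_hom p_pr V_simple psi_surj pw).1 rad.
congr pair.
  apply/ffunP=> j; rewrite ff1.
  have g1 := embed_grp psi rV z w j.
  have m0 : sdp_mod (embed rV psi z w j) = 0%R.
    apply/row_matrixP=> i; rewrite row0.
    apply: (homs (fun u => row i (sdp_mod (embed rV psi z u j)))).
    by apply: derivation_kernel_hom; apply: embed_derivation.
  by case: (embed rV psi z w j) g1 m0 => g x /= -> ->; rewrite pw.
apply/ffunP=> i; rewrite !ffunE.
have := homs _ (varrho_kernel_hom psi (gamma i)); have := varrho_grp psi (gamma i) w.
case: (varrho _ _ w) => g x /= ->; rewrite pw => /eqP.
by rewrite GRing.addr_eq0 => /eqP ->.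
Qed.

Theorem theorem5p2 (p : nat) (p_pr : prime p) (gT : finGroupType)
    (n : nat) (rV : mx_representation 'F_p [set: gT] n)
    (V_simple : mx_irreducible rV)
    (e : nat) (psi : {multiplicative free_group e -> gT})
    (psi_surj : forall h : gT, exists w : free_group e, psi w = h)
    (d : nat) (gamma : 'I_d -> cocycle2 rV) (gamma_basis : H2_basis gamma)
    (r : nat) (r_dim : abs_simple_dim rV r)
    (z : 'M['F_p]_(r, n)) (z_gen : cyclic_generator rV z) :
  (forall w : free_group e,
     rho psi z gamma w = 1 <-> proj_V psi rV (ident psi (Psi_p p psi w)) = 1)
  /\
  (exists f : {multiplicative Hhat_V psi rV -> rho_cod e r gamma},
     injective f /\
     forall y, (exists q, f q = y) <-> (exists w, rho psi z gamma w = y)).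
Proof.
have ker := rho_ker p_pr V_simple psi_surj gamma_basis
  (cyclic_generator_span V_simple r_dim z_gen).
split=> [w|]; first by rewrite ident_Psi_p.
have surj q : exists w, (proj_V psi rV \o proj_p p psi) w = q.
  have [x <-] := quot_proj_surj q; have [w <-] := proj_p_surj x.
  by exists w.
have [f [f_inj fE]] := mhom_factor surj ker.
exists f; split=> // y; split=> [[q <-]|[w <-]].
  by have [w <-] := surj q; exists w; rewrite -fE.
by exists (proj_V psi rV (proj_p p psi w)); rewrite -fE.
Qed.
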